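(* Let $u$ be a nonconstant inner function and let $\varphi\in L^\infty(\mathbb{T})$ with $\|\varphi\|_\infty=1$. Then the following are equivalent: (1) There exist inner functions $\psi_+$ and $\chi_+$ such that $\varphi=\overline{u}\,\overline{\psi_+}\,\chi_+$ a.e. on $\mathbb{T}$. (2) There exists a nonzero $h_0\in H^2$ such that the vector $f_0:=uh_0\oplus 0\in uH^2\oplus H^2_-=\mathcal{K}_u^\perp$ is extremal for $D_\varphi$, that is, $\|D_\varphi f_0\|=\|f_0\|$, and moreover $\varphi u h_0\in H^2$.
   Context: $\mathbb{T}$ is the unit circle with normalized arc-length measure $m$, $L^2=L^2(\mathbb{T})$, $L^\infty=L^\infty(\mathbb{T})$. $H^2\subset L^2$ is the Hardy space of functions whose Fourier coefficients of negative index vanish, $H^2_-=L^2\ominus H^2$, and $H^\infty=H^2\cap L^\infty$. An inner function is a $u\in H^\infty$ with $|u|=1$ a.e. on $\mathbb{T}$. The model space is $\mathcal{K}_u=H^2\ominus uH^2$; its orthogonal complement in $L^2$ is $\mathcal{K}_u^\perp=uH^2\oplus H^2_-$, and $x\oplus y$ (with $x\in uH^2$, $y\in H^2_-$) is identified with $x+y\in L^2$. $P_{\mathcal{K}_u}$ is the orthogonal projection of $L^2$ onto $\mathcal{K}_u$. The dual truncated Toeplitz operator with symbol $\varphi\in L^\infty$ is $D_\varphi:\mathcal{K}_u^\perp\to\mathcal{K}_u^\perp$, $D_\varphi h=(I-P_{\mathcal{K}_u})(\varphi h)$. One has $\|D_\varphi\|=\|\varphi\|_\infty$. *)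

(* Defs.v *)
From HB Require Import structures.
From mathcomp Require Import all_boot all_order all_algebra.
From mathcomp Require Import complex.
From mathcomp Require Import all_classical all_reals all_analysis.
From mathcomp Require Import measurable_realfun.

Set Implicit Arguments.
Unset Strict Implicit.
Unset Printing Implicit Defensive.
Import Order.TTheory GRing.Theory Num.Theory.
Import numFieldNormedType.Exports.
Local Open Scope classical_set_scope.
Local Open Scope ring_scope.

(* The norm `|z| of R[i] takes its values in R[i]; normc is R-valued. *)
Notation normc := ComplexField.Normc.normc.

Definition circle (R : realType) := {z : R[i] | normc z == 1}.

Section circle.
Variable R : realType.
Implicit Type t : R.

Definition circle_coord (z : circle R) : R * R :=
  (complex.Re (val z), complex.Im (val z)).

Fact normc_expi t : normc (Complex (cos t) (sin t)) == 1.
Proof. by rewrite /= cos2Dsin2 sqrtr1. Qed.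

Definition expi (t : measurableTypeR R) : circle R :=
  Sub (Complex (cos t) (sin t)) (normc_expi t).

HB.instance Definition _ := Choice.on (circle R).
HB.instance Definition _ := isPointed.Build (circle R) (expi 0).

(* The Borel sigma-algebra, as the trace of the one of R * R. *)
HB.instance Definition _ := Measurable.copy (circle R)
  (g_sigma_algebra_preimageType circle_coord).

Fact measurable_expi : measurable_fun [set: measurableTypeR R] expi.
Proof.
move=> _ /= _ [B mB <-]; rewrite 2!setTI.
have mcs : measurable_fun [set: R] (fun t => (cos t, sin t)).
  apply: measurable_fun_pair.
    apply: continuous_measurable_fun; exact: continuous_cos.
  apply: continuous_measurable_fun; exact: continuous_sin.
by rewrite -[X in measurable X]setTI; exact: (mcs measurableT _ mB).
Qed.

HB.instance Definition _ := isMeasurableFun.Build _ _ _ _ expi measurable_expi.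

Fact twopi_gt0 : (0 : R) < 2 * pi.
Proof. by rewrite mulr_gt0 ?pi_gt0. Qed.

Definition arc_length : set (circle R) -> \bar R :=
  distribution (uniform_prob twopi_gt0) expi.

HB.instance Definition _ := Probability.on arc_length.

End circle.
Arguments arc_length R : clear implicits.

(* Elements of L^p are represented by functions rather than by classes modulo *)
(* a.e. equality: equalities between them are to be stated a.e., and the      *)
(* subspaces of L^2 below are sets of functions saturated for a.e. equality   *)
(* among measurable functions.                                                *)
Section spaces.
Variable R : realType.
Local Notation m := (arc_length R).
Implicit Types (f g h u phi : circle R -> R[i]) (V W : set (circle R -> R[i])).

Definition cmeasurable f :=
  measurable_fun setT (fun z => complex.Re (f z)) /\
  measurable_fun setT (fun z => complex.Im (f z)).

Definition cLnorm (p : \bar R) f : \bar R :=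
  Lnorm m p (fun z => (normc (f z))%:E).

Definition cLp (p : \bar R) : set (circle R -> R[i]) :=
  [set f | cmeasurable f /\ (cLnorm p f < +oo)%E].

Definition cintegral f : R[i] :=
  Complex (\int[m]_z complex.Re (f z)) (\int[m]_z complex.Im (f z)).

Definition dotL2 f g : R[i] := cintegral (fun z => f z * conjc (g z)).

Definition fourier f (n : int) : R[i] := dotL2 f (fun z => val z ^ n).

Definition H2 : set (circle R -> R[i]) :=
  [set f | cLp 2%:E f /\ forall n : int, n < 0 -> fourier f n = 0].

Definition Hoo : set (circle R -> R[i]) := H2 `&` cLp +oo%E.

Definition inner_fun u := Hoo u /\ \forall z \ae m, normc (u z) = 1.

Definition ae_constant f := exists c : R[i], \forall z \ae m, f z = c.

Definition ominus V W : set (circle R -> R[i]) :=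
  [set f | V f /\ forall g, W g -> dotL2 f g = 0].

Definition model_space u := ominus H2 [set u \* h | h in H2].

Definition model_space_perp u := ominus (cLp 2%:E) (model_space u).

(* A representative of the orthogonal projection of f onto V; 0 is only the   *)
(* default value of xget when there is no projection, which does not happen   *)
(* for f in L^2 and V closed.                                                 *)
Definition oproj V f : circle R -> R[i] :=
  xget (cst 0) [set g | V g /\ forall h, V h -> dotL2 (f \- g) h = 0].

Definition dual_toeplitz u phi f : circle R -> R[i] :=
  (phi \* f) \- oproj (model_space u) (phi \* f).

(* The operator norm is the L^oo norm of phi, so that this is the extremality *)
(* of f when that norm is 1. The first conjunct is the domain condition.      *)
Definition extremal u phi f :=
  model_space_perp u f /\
  cLnorm 2%:E (dual_toeplitz u phi f) = cLnorm 2%:E f.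

End spaces.

(* Main.v *)
Require Import Defs.
From mathcomp Require Import all_boot all_order all_algebra.
From mathcomp Require Import complex.
From mathcomp Require Import all_classical all_reals all_analysis.
From mathcomp Require Import measurable_realfun ess_sup_inf ring lra.

(** If phi is the product of chi with the conjugates of u and psi, take
    h0 = psi u. Then phi u h0 = u chi almost everywhere,
    which lies in u H^2 and is therefore left alone by the projection, and both
    vectors are unimodular.

    Conversely, the dual Toeplitz operator is multiplication by phi, with
    |phi| <= 1, followed by an orthogonal projection, so extremality of u h0
    forces |phi| = 1 wherever h0 is nonzero. Let E be the closure in L^2 of the
    multiples of h0 by analytic polynomials. Beurling's argument provides an
    inner function psi in E ([inner_in_closure]). All elements of E vanish where
    h0 does and |psi| = 1, so h0 is nonzero almost everywhere ([H2_neq0_ae]) and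
    |phi| = 1. The function w = phi u maps h0 into H^2, hence the polynomial
    multiples of h0, hence E ([fourier_closure]); so chi = w psi is inner, and
    phi is the product of chi with the conjugates of u and psi. Behind this is the
    inner-outer factorization: h0 and phi u h0 have the same outer factor, and
    psi and chi are their inner factors.

    Three facts of analysis carry this. An integrable function without Fourier
    coefficients is null ([fourier_null_ae0]): the bounded functions that
    preserve this property under multiplication contain the coordinates and are
    closed under bounded limits, hence contain the indicators of half-planes,
    thus of all Borel sets. L^2 is complete ([L2_complete]), so that vectors have
    projections onto closures of subspaces ([projection]). The product of an
    inner function with an element of H^2 is in H^2 ([H2M]), because by the
    first two facts an element of H^2 is a limit of analytic polynomials. *)

Set Implicit Arguments.
Unset Strict Implicit.
Unset Printing Implicit Defensive.
Import Order.TTheory GRing.Theory Num.Theory.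
Import numFieldNormedType.Exports.
Local Open Scope classical_set_scope.
Local Open Scope ring_scope.

Local Notation Re := complex.Re.
Local Notation Im := complex.Im.

(** * The squared modulus of a complex number *)

Section square_modulus.
Variable R : rcfType.
Implicit Types x y : R[i].

(** The R-valued square of the modulus: polynomial in the components, it spares
    the square root in [normc] and the R[i]-valued norm. *)
Definition nsq x : R := Re x ^+ 2 + Im x ^+ 2.

Lemma complex_ext x y : Re x = Re y -> Im x = Im y -> x = y.
Proof. by case: x y => a b [c d] /= -> ->. Qed.

Lemma ReD x y : Re (x + y) = Re x + Re y. Proof. by case: x; case: y. Qed.
Lemma ImD x y : Im (x + y) = Im x + Im y. Proof. by case: x; case: y. Qed.
Lemma ReN x : Re (- x) = - Re x. Proof. by case: x. Qed.
Lemma ImN x : Im (- x) = - Im x. Proof. by case: x. Qed.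
Lemma ReM x y : Re (x * y) = Re x * Re y - Im x * Im y.
Proof. by case: x; case: y. Qed.
Lemma ImM x y : Im (x * y) = Re x * Im y + Im x * Re y.
Proof. by case: x; case: y. Qed.
Lemma ReJ x : Re (conjc x) = Re x. Proof. by case: x. Qed.
Lemma ImJ x : Im (conjc x) = - Im x. Proof. by case: x. Qed.

Definition reim := (ReD, ImD, ReN, ImN, ReM, ImM, ReJ, ImJ).

Lemma nsq_ge0 x : 0 <= nsq x.
Proof. by rewrite addr_ge0 ?sqr_ge0. Qed.

Lemma nsq0 : nsq 0 = 0. Proof. by rewrite /nsq /= expr0n addr0. Qed.

Lemma nsq1 : nsq 1 = 1. Proof. by rewrite /nsq /= expr1n expr0n addr0. Qed.

Lemma nsq_eq0 x : nsq x = 0 -> x = 0.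
Proof.
move=> /eqP; rewrite paddr_eq0 ?sqr_ge0// !sqrf_eq0 => /andP[/eqP a /eqP b].
exact: complex_ext.
Qed.

Lemma nsqM x y : nsq (x * y) = nsq x * nsq y.
Proof. by rewrite /nsq !reim; ring. Qed.

Lemma nsqJ x : nsq (conjc x) = nsq x.
Proof. by rewrite /nsq !reim sqrrN. Qed.

Lemma nsqN x : nsq (- x) = nsq x.
Proof. by rewrite /nsq !reim !sqrrN. Qed.

Lemma nsqR (a : R) : nsq a%:C%C = a ^+ 2.
Proof. by rewrite /nsq /= expr0n addr0. Qed.

Lemma le_nsqD x y : nsq (x + y) <= 2 * nsq x + 2 * nsq y.
Proof.
rewrite /nsq !reim.
have := sqr_ge0 (Re x - Re y); have := sqr_ge0 (Im x - Im y); nra.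
Qed.

Lemma nsq_parallelogram x y : nsq (x - y) + nsq (x + y) = 2 * nsq x + 2 * nsq y.
Proof. by rewrite /nsq !reim; ring. Qed.

Lemma mulJ_nsq x : x * conjc x = (nsq x)%:C%C.
Proof. by apply: complex_ext; rewrite !reim /nsq /=; ring. Qed.

Lemma normc_nsq x : normc x = Num.sqrt (nsq x).
Proof. by case: x. Qed.

Lemma normc_sqr x : normc x ^+ 2 = nsq x.
Proof. by rewrite normc_nsq sqr_sqrtr// nsq_ge0. Qed.

Lemma normc_eq1 x : normc x = 1 <-> nsq x = 1.
Proof.
split=> [h|h]; first by rewrite -normc_sqr h expr1n.
by rewrite normc_nsq h sqrtr1.
Qed.

Lemma normc_le1 x : (normc x <= 1) = (nsq x <= 1).
Proof. by rewrite normc_nsq -{1}sqrtr1 ler_sqrt. Qed.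

Lemma abs_ReM_le x y : `|Re (x * y)| <= nsq x + nsq y.
Proof.
rewrite ler_norml /nsq !reim.
have := sqr_ge0 (Re x - Re y); have := sqr_ge0 (Re x + Re y).
have := sqr_ge0 (Im x - Im y); have := sqr_ge0 (Im x + Im y).
by move=> h1 h2 h3 h4; apply/andP; split; nra.
Qed.

Lemma abs_ImM_le x y : `|Im (x * y)| <= nsq x + nsq y.
Proof.
rewrite ler_norml /nsq !reim.
have := sqr_ge0 (Re x - Im y); have := sqr_ge0 (Re x + Im y).
have := sqr_ge0 (Im x - Re y); have := sqr_ge0 (Im x + Re y).
by move=> h1 h2 h3 h4; apply/andP; split; nra.
Qed.

Lemma unimodular_inv x : nsq x = 1 -> x^-1 = conjc x.
Proof.
move=> x1; have x0 : x != 0.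
  by apply/eqP => x0; move: x1; rewrite x0 nsq0 => /esym/eqP; rewrite oner_eq0.
by apply: (mulfI x0); rewrite mulfV// mulJ_nsq x1.
Qed.

Lemma nsqX x n : nsq (x ^+ n) = nsq x ^+ n.
Proof. by elim: n => [|n ih]; rewrite ?expr0 ?nsq1// !exprS nsqM ih. Qed.

Lemma nsq_exprz x (n : int) : nsq x = 1 -> nsq (x ^ n) = 1.
Proof.
move=> x1; case: n => n; first by rewrite -exprnP nsqX x1 expr1n.
by rewrite NegzE -exprz_inv -exprnP nsqX unimodular_inv// nsqJ x1 expr1n.
Qed.

Lemma conjc_exprz x (n : int) : nsq x = 1 -> conjc (x ^ n) = x ^ (- n).
Proof.
move=> x1; have xn1 := nsq_exprz n x1.
by rewrite -unimodular_inv// -invr_expz.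
Qed.

End square_modulus.

(** * Measurability and integration on the circle *)

Section integrals.
Variable R : realType.
Local Notation m := (arc_length R).
Local Notation C := R[i].
Implicit Types f g h : circle R -> C.

Lemma cmeasurableD f g : cmeasurable f -> cmeasurable g -> cmeasurable (f \+ g).
Proof.
move=> [f1 f2] [g1 g2]; split.
  under eq_fun do rewrite reim; exact: measurable_funD.
under eq_fun do rewrite reim; exact: measurable_funD.
Qed.

Lemma cmeasurableM f g : cmeasurable f -> cmeasurable g -> cmeasurable (f \* g).
Proof.
move=> [f1 f2] [g1 g2]; split.
  under eq_fun do rewrite reim.
  by apply: measurable_funB; exact: measurable_funM.
under eq_fun do rewrite reim.
by apply: measurable_funD; exact: measurable_funM.
Qed.

Lemma cmeasurable_cst (c : C) : cmeasurable (fun=> c : C).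
Proof. by split; exact: measurable_cst. Qed.

Lemma cmeasurableN f : cmeasurable f -> cmeasurable (\- f).
Proof.
move=> [f1 f2]; split.
  under eq_fun do rewrite reim; exact: measurable_funN.
under eq_fun do rewrite reim; exact: measurable_funN.
Qed.

Lemma cmeasurableB f g : cmeasurable f -> cmeasurable g -> cmeasurable (f \- g).
Proof. by move=> mf mg; apply: cmeasurableD => //; exact: cmeasurableN. Qed.

Lemma cmeasurableJ f : cmeasurable f -> cmeasurable (fun z => conjc (f z)).
Proof.
move=> [f1 f2]; split; first by under eq_fun do rewrite reim.
under eq_fun do rewrite reim; exact: measurable_funN.
Qed.

Lemma measurable_nsq f : cmeasurable f -> measurable_fun setT (fun z => nsq (f z)).
Proof.
by move=> [f1 f2]; apply: measurable_funD; exact: measurable_funX.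
Qed.

Lemma measurable_circle_coord : measurable_fun setT (@circle_coord R).
Proof.
by move=> _ B mB; rewrite setTI; exists B => //; rewrite setTI.
Qed.

Lemma cmeasurable_val : cmeasurable (fun z : circle R => val z).
Proof.
split.
  exact: (measurableT_comp (@measurable_fst _ _ _ _) measurable_circle_coord).
exact: (measurableT_comp (@measurable_snd _ _ _ _) measurable_circle_coord).
Qed.

Lemma nsq_val (z : circle R) : nsq (val z) = 1.
Proof. by apply/normc_eq1; apply/eqP; exact: (valP z). Qed.

Lemma nsq_valX (z : circle R) (n : int) : nsq (val z ^ n) = 1.
Proof. exact/nsq_exprz/nsq_val. Qed.

Lemma val_neq0 (z : circle R) : val z != 0.
Proof.
apply/eqP => z0; have := nsq_val z.
by rewrite z0 nsq0 => /esym/eqP; rewrite oner_eq0.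
Qed.

Lemma cmeasurable_valX (n : int) : cmeasurable (fun z : circle R => val z ^ n).
Proof.
have pos (k : nat) : cmeasurable (fun z : circle R => val z ^+ k).
  elim: k => [|k ih]; first exact: cmeasurable_cst.
  under [X in cmeasurable X]eq_fun do rewrite exprS.
  by apply: cmeasurableM => //; exact: cmeasurable_val.
case: n => n; first exact: pos.
have -> : (fun z : circle R => val z ^ Negz n) =
          (fun z => conjc (val z ^+ n.+1)).
  apply/funext => z.
  by rewrite exprnP conjc_exprz ?nsq_val// NegzE.
exact: cmeasurableJ.
Qed.

Lemma cmeasurable_indic (A : set (circle R)) : measurable A ->
  cmeasurable (fun z => (\1_A z : R)%:C%C).
Proof. by move=> mA; split => //=; exact: measurable_indic. Qed.

(** Integrability of both components, so that [cintegral] is not a default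
    value. *)
Definition cintegrable f :=
  m.-integrable setT (EFin \o (fun z => Re (f z))) /\
  m.-integrable setT (EFin \o (fun z => Im (f z))).

Lemma integrable_dom (a b : circle R -> R) : measurable_fun setT a ->
  (forall z, `|a z| <= b z) -> m.-integrable setT (EFin \o b) ->
  m.-integrable setT (EFin \o a).
Proof.
move=> ma ab; apply: le_integrable => //; first exact/measurable_EFinP.
by move=> z _ /=; rewrite lee_fin (le_trans (ab z))// ler_norm.
Qed.

Lemma cintegrable_dom f (b : circle R -> R) : cmeasurable f ->
  (forall z, `|Re (f z)| <= b z) -> (forall z, `|Im (f z)| <= b z) ->
  m.-integrable setT (EFin \o b) -> cintegrable f.
Proof. by move=> [? ?] fb1 fb2 ib; split; exact: integrable_dom ib. Qed.

Lemma cintegrable_meas f : cintegrable f -> cmeasurable f.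
Proof. by move=> [/measurable_int/measurable_EFinP ? /measurable_int/measurable_EFinP ?]. Qed.

Lemma integrableRD (a b : circle R -> R) : m.-integrable setT (EFin \o a) ->
  m.-integrable setT (EFin \o b) ->
  m.-integrable setT (EFin \o (fun z => a z + b z)).
Proof.
move=> ia ib.
by rewrite (_ : _ \o _ = (EFin \o a) \+ (EFin \o b))%E//; exact: integrableD.
Qed.

Lemma integrableRZ (a : circle R -> R) c : m.-integrable setT (EFin \o a) ->
  m.-integrable setT (EFin \o (fun z => c * a z)).
Proof.
move=> ia.
rewrite (_ : _ \o _ = (fun z => c%:E * (EFin \o a) z))%E//; exact: integrableZl.
Qed.

Lemma integrableR_cst (c : R) : m.-integrable setT (EFin \o (fun=> c)).
Proof. exact: finite_measure_integrable_cst. Qed.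

Lemma cintegrable_bdd f (M : R) : cmeasurable f -> (forall z, nsq (f z) <= M) ->
  cintegrable f.
Proof.
move=> mf fM; apply: (@cintegrable_dom _ (fun=> 1 + M)) => //.
- move=> z; rewrite ler_norml; have := fM z; rewrite /nsq.
  by move=> h; apply/andP; split; nra.
- move=> z; rewrite ler_norml; have := fM z; rewrite /nsq.
  by move=> h; apply/andP; split; nra.
- exact: integrableR_cst.
Qed.

Lemma cintegrableD f g : cintegrable f -> cintegrable g -> cintegrable (f \+ g).
Proof.
move=> [f1 f2] [g1 g2]; split.
  rewrite /comp; under eq_fun do rewrite reim; exact: integrableRD.
rewrite /comp; under eq_fun do rewrite reim; exact: integrableRD.
Qed.

Lemma cintegralD f g : cintegrable f -> cintegrable g ->
  cintegral (f \+ g) = cintegral f + cintegral g.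
Proof.
move=> [f1 f2] [g1 g2]; apply: complex_ext; rewrite reim /=.
  under eq_Rintegral do rewrite reim; exact: RintegralD.
under eq_Rintegral do rewrite reim; exact: RintegralD.
Qed.

Lemma cintegrableZ (c : C) f : cintegrable f -> cintegrable (fun z => c * f z).
Proof.
move=> [f1 f2]; split; rewrite /comp.
  under eq_fun do rewrite reim -mulNr; apply: integrableRD; exact: integrableRZ.
under eq_fun do rewrite reim; apply: integrableRD; exact: integrableRZ.
Qed.

Lemma cintegralZ (c : C) f : cintegrable f ->
  cintegral (fun z => c * f z) = c * cintegral f.
Proof.
move=> [f1 f2]; apply: complex_ext; rewrite reim /=.
  under eq_Rintegral do rewrite reim -mulNr.
  by rewrite RintegralD ?RintegralZl ?mulNr//; exact: integrableRZ.
under eq_Rintegral do rewrite reim.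
by rewrite RintegralD ?RintegralZl//; exact: integrableRZ.
Qed.

Lemma eq_cintegral f g : f =1 g -> cintegral f = cintegral g.
Proof. by move=> /funext ->. Qed.

Lemma ae_eq_Rintegral (a b : circle R -> R) :
  measurable_fun setT a -> measurable_fun setT b ->
  (\forall z \ae m, a z = b z) -> \int[m]_z a z = \int[m]_z b z.
Proof.
move=> ma mb ab; rewrite /Rintegral; congr fine.
apply: ae_eq_integral => //; [exact/measurable_EFinP|exact/measurable_EFinP|].
by apply: filterS ab => z ->.
Qed.

Lemma ae_eq_cintegral f g : cmeasurable f -> cmeasurable g ->
  (\forall z \ae m, f z = g z) -> cintegral f = cintegral g.
Proof.
move=> [f1 f2] [g1 g2] fg; apply: complex_ext => /=.
  by apply: ae_eq_Rintegral => //; apply: filterS fg => z ->.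
by apply: ae_eq_Rintegral => //; apply: filterS fg => z ->.
Qed.

Lemma cintegralJ f : cintegrable f ->
  cintegral (fun z => conjc (f z)) = conjc (cintegral f).
Proof.
move=> [f1 f2]; apply: complex_ext; rewrite /= ?reim /=.
  by apply: eq_Rintegral => z _; rewrite reim.
rewrite -mulN1r -RintegralZl//.
by apply: eq_Rintegral => z _; rewrite reim mulN1r.
Qed.

Lemma ae_integrable (a b : circle R -> R) :
  measurable_fun setT a -> m.-integrable setT (EFin \o b) ->
  (\forall z \ae m, `|a z| <= b z) -> m.-integrable setT (EFin \o a).
Proof.
move=> ma /integrableP[mb ib] ab; apply/integrableP; split.
  exact/measurable_EFinP.
apply: le_lt_trans ib; apply: ae_ge0_le_integral => //.
- by do 2 apply: measurableT_comp => //.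
- by do 1 apply: measurableT_comp => //.
- by apply: filterS ab => z ab _ /=; rewrite lee_fin (le_trans ab)// ler_norm.
Qed.

End integrals.

(** * Polynomials converging to a step *)

Section step_polynomials.
Variable R : realType.
Implicit Types t y : R.

Lemma bernoulli_ge y n : 0 <= y <= 1 -> 1 - n%:R * y <= (1 - y) ^+ n.
Proof.
move=> /andP[y0 y1]; elim: n => [|n ih]; first by rewrite expr0 mul0r subr0.
have yn0 : 0 <= (1 - y) ^+ n by rewrite exprn_ge0// subr_ge0.
have n0 : 0 <= n%:R :> R by [].
rewrite exprS -natr1; apply: (@le_trans _ _ ((1 - y) * (1 - n%:R * y))); first nra.
by rewrite ler_wpM2l// subr_ge0.
Qed.

Lemma bernoulli_le y n : 0 <= y -> 1 + n%:R * y <= (1 + y) ^+ n.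
Proof.
move=> y0; elim: n => [|n ih]; first by rewrite expr0 mul0r addr0.
have n0 : 0 <= n%:R :> R by [].
rewrite exprS -natr1; apply: (@le_trans _ _ ((1 + y) * (1 + n%:R * y))); first nra.
by rewrite ler_wpM2l// addr_ge0.
Qed.

(** Since (1 - y)(1 + y) = 1 - y^2 is at most 1, the growth of (1 + y)^n bounds
    the decay of (1 - y)^n. *)
Lemma exp_bernoulli_le1 y n : 0 <= y <= 1 -> (1 - y) ^+ n * (1 + n%:R * y) <= 1.
Proof.
move=> /andP[y0 y1].
apply: (@le_trans _ _ ((1 - y) ^+ n * (1 + y) ^+ n)).
  by rewrite ler_wpM2l ?bernoulli_le// exprn_ge0// subr_ge0.
by rewrite -exprMn exprn_ile1//; nra.
Qed.

Lemma cvg_harmonic_succ : (1 + n%:R : R)^-1 @[n --> \oo] --> (0 : R).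
Proof.
rewrite (_ : (fun n => _) = @harmonic R); first exact: cvg_harmonic.
by apply/funext => n; rewrite /harmonic /= -natr1 addrC.
Qed.

Lemma cvg_nX y : 0 <= y < 1 -> n%:R * y ^+ n @[n --> \oo] --> (0 : R).
Proof.
move=> /andP[y0 y1].
(* with s = sqrt y, n s^n stays bounded, so that n y^n = (n s^n) s^n vanishes *)
pose s := Num.sqrt y.
have s0 : 0 <= s by exact: sqrtr_ge0.
have s2 : s ^+ 2 = y by rewrite sqr_sqrtr.
have s1 : s < 1 by rewrite -[ltRHS]sqrtr1 ltr_sqrt.
have b n : n%:R * y ^+ n <= (1 - s)^-1 * s ^+ n.
  rewrite -s2 -exprM mulnC exprM expr2 mulrA ler_wpM2r ?exprn_ge0//.
  have := @exp_bernoulli_le1 (1 - s) n.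
  rewrite subr_ge0 (ltW s1) lerBlDr lerDl s0 opprB addrCA subrr addr0.
  move=> /(_ isT) h; rewrite -[leRHS]mul1r ler_pdivlMr ?subr_gt0//.
  have := exprn_ge0 n s0; have : 0 <= n%:R :> R by [].
  by move: h; set a := s ^+ n; set k := n%:R; nra.
apply: (@squeeze_cvgr _ _ _ _ (fun=> 0) (fun n => (1 - s)^-1 * s ^+ n)).
- by apply: nearW => n; rewrite b mulr_ge0 ?exprn_ge0.
- exact: cvg_cst.
- rewrite -[X in _ --> X](mulr0 (1 - s)^-1); apply: cvgM; first exact: cvg_cst.
  by apply: cvg_expr; rewrite ger0_norm.
Qed.

(** These polynomials, bounded by 1 on the unit interval, converge there to the
    indicator of the half-open interval below 1/2: the exponent is large
    against 2^n, and n (2t)^n still vanishes for t < 1/2. *)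
Definition step_poly n t : R := (1 - t ^+ n) ^+ (n * 2 ^ n).

Lemma step_poly_bounds n t : 0 <= t <= 1 -> 0 <= step_poly n t <= 1.
Proof.
move=> /andP[t0 t1]; have a0 := exprn_ge0 n t0.
have a1 : t ^+ n <= 1 by rewrite exprn_ile1.
by rewrite exprn_ge0 ?subr_ge0//= exprn_ile1 ?subr_ge0// lerBlDr lerDl.
Qed.

Lemma cvg_step_poly t : 0 <= t <= 1 ->
  step_poly n t @[n --> \oo] --> ((t < 2^-1)%R%:R : R).
Proof.
move=> /andP[t0 t1].
have tn n : 0 <= t ^+ n <= 1 by rewrite exprn_ge0//= exprn_ile1.
have [th|th] := ltP t 2^-1.
  apply: (@squeeze_cvgr _ _ _ _ (fun n => 1 - n%:R * (2 * t) ^+ n) (fun=> 1)).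
  - apply: nearW => n; have := @step_poly_bounds n t.
    rewrite t0 t1 => /(_ isT)/andP[_ ->]; rewrite andbT.
    have := @bernoulli_ge _ (n * 2 ^ n) (tn n).
    by rewrite natrM natrX -mulrA -exprMn.
  - rewrite -[X in _ --> X]subr0; apply: cvgB; first exact: cvg_cst.
    by apply: cvg_nX; apply/andP; split; lra.
  - exact: cvg_cst.
apply: (@squeeze_cvgr _ _ _ _ (fun=> 0) (fun n => (1 + n%:R)^-1)).
- apply: nearW => n; have := @step_poly_bounds n t.
  rewrite t0 t1 => /(_ isT)/andP[-> _] /=.
  have := @exp_bernoulli_le1 _ (n * 2 ^ n) (tn n).
  have -> : (n * 2 ^ n)%:R * t ^+ n = n%:R * (2 * t) ^+ n.
    by rewrite natrM natrX -mulrA -exprMn.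
  move=> h; rewrite -[leRHS]mul1r ler_pdivlMr ?ltr_pwDl//.
  apply: le_trans h; apply: ler_wpM2l; first by rewrite exprn_ge0// subr_ge0; case/andP: (tn n).
  rewrite lerD2l ler_peMr// exprn_ege1//; lra.
- exact: cvg_cst.
- exact: cvg_harmonic_succ.
Qed.

End step_polynomials.

(** * Uniqueness of Fourier coefficients *)

Section uniqueness.
Variable R : realType.
Local Notation m := (arc_length R).
Local Notation C := R[i].
Implicit Types (f g : circle R -> C) (a b : circle R -> R).

Lemma cintegrableM_bdd (w f : circle R -> C) (M : R) : cmeasurable w ->
  (forall z, nsq (w z) <= M) -> cintegrable f -> cintegrable (w \* f).
Proof.
move=> mw wM fi; have [f1 f2] := fi.
have bd z : `|Re (w z)| <= 1 + M /\ `|Im (w z)| <= 1 + M.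
  by have := wM z; rewrite /nsq !ler_norml => h; split; apply/andP; split; nra.
apply: (@cintegrable_dom _ _
    (fun z => (1 + M) * (`|Re (f z)| + `|Im (f z)|))).
- by apply: cmeasurableM => //; exact: cintegrable_meas.
- move=> z; have [b1 b2] := bd z; rewrite reim (le_trans (ler_normB _ _))//.
  by rewrite !normrM mulrDr lerD// ler_wpM2r.
- move=> z; have [b1 b2] := bd z; rewrite reim (le_trans (ler_normD _ _))//.
  by rewrite !normrM mulrDr addrC lerD// ler_wpM2r.
apply: integrableRZ; apply: integrableRD.
  exact: (integrable_norm f1).
exact: (integrable_norm f2).
Qed.

Definition fourier_null f :=
  cintegrable f /\ forall n : int, cintegral (fun z => f z * val z ^ n) = 0.

(** The bound is included so that multipliers form an algebra of bounded
    functions; uniqueness of Fourier coefficients amounts to indicators of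
    measurable sets being multipliers. *)
Definition multiplier a := [/\ measurable_fun setT a,
  exists M, forall z, `|a z| <= M &
  forall f, fourier_null f ->
    forall n : int, cintegral (fun z => (a z)%:C%C * f z * val z ^ n) = 0].

Lemma cintegrable_valX f (n : int) : cintegrable f ->
  cintegrable (fun z => f z * val z ^ n).
Proof.
move=> fi; rewrite (_ : (fun _ => _) = (fun z => val z ^ n) \* f); last first.
  by apply/funext => z /=; rewrite mulrC.
apply: (@cintegrableM_bdd _ _ 1) => //; first exact: cmeasurable_valX.
by move=> z; rewrite nsq_valX.
Qed.

Lemma cintegrable_bddR a f : measurable_fun setT a ->
  (exists M, forall z, `|a z| <= M) -> cintegrable f ->
  cintegrable (fun z => (a z)%:C%C * f z).
Proof.
move=> ma [M aM] fi; apply: (@cintegrableM_bdd (fun z => (a z)%:C%C) f (M ^+ 2)) => //.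
by move=> z; rewrite nsqR -real_normK ?num_real// lerXn2r// nnegrE (le_trans _ (aM z)).
Qed.

Lemma fourier_nullM a f : multiplier a -> fourier_null f ->
  fourier_null (fun z => (a z)%:C%C * f z).
Proof.
move=> [ma ba nf] fn; split; last exact: nf.
by apply: cintegrable_bddR => //; case: fn.
Qed.

Lemma fourier_null_valX f (k : int) : fourier_null f ->
  fourier_null (fun z => f z * val z ^ k).
Proof.
move=> [fi f0]; split=> [|n]; first exact: cintegrable_valX.
rewrite -[RHS](f0 (k + n)); apply: eq_cintegral => z.
by rewrite -mulrA expfzDr// val_neq0.
Qed.

Lemma multiplierM a b : multiplier a -> multiplier b ->
  multiplier (fun z => a z * b z).
Proof.
move=> Ma Mb; have [ma [M aM] _] := Ma; have [mb [N bN] _] := Mb; split.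
- exact: measurable_funM.
- by exists (M * N) => z; rewrite normrM ler_pM.
- move=> f fn n; have [_ h] := fourier_nullM Ma (fourier_nullM Mb fn).
  rewrite -[RHS](h n); apply: eq_cintegral => z.
  by rewrite (rmorphM (real_complex R)) !mulrA.
Qed.

Lemma multiplierD a b : multiplier a -> multiplier b ->
  multiplier (fun z => a z + b z).
Proof.
move=> Ma Mb; have [ma [M aM] _] := Ma; have [mb [N bN] _] := Mb; split.
- exact: measurable_funD.
- by exists (M + N) => z; rewrite (le_trans (ler_normD _ _))// lerD.
- move=> f fn n.
  have [ia ha] := fourier_nullM Ma fn; have [ib hb] := fourier_nullM Mb fn.
  have -> : 0 = 0 + 0 :> C by rewrite addr0.
  rewrite -{1}(ha n) -(hb n) -cintegralD; try exact: cintegrable_valX.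
  by apply: eq_cintegral => z /=; rewrite (rmorphD (real_complex R)) !mulrDl.
Qed.

Lemma multiplier_cst (c : R) : multiplier (fun=> c).
Proof.
split; [exact: measurable_cst|by exists (`|c|)|move=> f [fi fn] n].
rewrite (@eq_cintegral _ _ (fun z => c%:C%C * (f z * val z ^ n))); last first.
  by move=> z; rewrite mulrA.
by rewrite cintegralZ ?fn ?mulr0//; exact: cintegrable_valX.
Qed.

Lemma multiplierX a n : multiplier a -> multiplier (fun z => a z ^+ n).
Proof.
move=> Ma; elim: n => [|n ih]; first exact: multiplier_cst.
under [X in multiplier X]eq_fun do rewrite exprS.
exact: multiplierM.
Qed.

Lemma multiplier_affine a (c d : R) : multiplier a ->
  multiplier (fun z => c + d * a z).
Proof.
move=> Ma; apply: multiplierD; first exact: multiplier_cst.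
by apply: multiplierM => //; exact: multiplier_cst.
Qed.

Lemma Re_val (z : circle R) :
  (Re (val z))%:C%C = 2^-1%:C%C * val z ^ 1 + 2^-1%:C%C * val z ^ (-1).
Proof.
rewrite expr1z -conjc_exprz ?nsq_val// expr1z.
by apply: complex_ext; rewrite !reim /= ; field.
Qed.

Lemma Im_val (z : circle R) :
  (Im (val z))%:C%C = Complex 0 (- 2^-1) * val z ^ 1 + Complex 0 2^-1 * val z ^ (-1).
Proof.
rewrite expr1z -conjc_exprz ?nsq_val// expr1z.
by apply: complex_ext; rewrite !reim /= ; field.
Qed.

(** Multiplying by z or by its inverse only shifts the Fourier coefficients. *)
Lemma trig_multiplier a (c d : C) : measurable_fun setT a ->
  (forall z, `|a z| <= 1) ->
  (forall z, (a z)%:C%C = c * val z ^ 1 + d * val z ^ (-1)) -> multiplier a.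
Proof.
move=> ma a1 aE; split => //; first by exists 1.
move=> f fn n.
have [i1 h1] := fourier_null_valX 1 fn; have [i2 h2] := fourier_null_valX (-1) fn.
rewrite (@eq_cintegral _ _ ((fun z => c * (f z * val z ^ 1 * val z ^ n)) \+
    (fun z => d * (f z * val z ^ (-1) * val z ^ n)))); last first.
  by move=> z /=; rewrite aE !mulrDl -!mulrA ![_ * (f z * _)]mulrCA.
have j1 := cintegrable_valX n i1; have j2 := cintegrable_valX n i2.
rewrite cintegralD; [|exact: cintegrableZ..].
by rewrite !cintegralZ// h1 h2 !mulr0 addr0.
Qed.

Lemma abs_val (z : circle R) : `|Re (val z)| <= 1 /\ `|Im (val z)| <= 1.
Proof.
by have := nsq_val z; rewrite /nsq !ler_norml => h; split; apply/andP; split; nra.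
Qed.

Lemma multiplier_Re : multiplier (fun z => Re (val z)).
Proof.
apply: (trig_multiplier _ _ Re_val); first by case: (@cmeasurable_val R).
by move=> z; case: (abs_val z).
Qed.

Lemma multiplier_Im : multiplier (fun z => Im (val z)).
Proof.
apply: (trig_multiplier _ _ Im_val); first by case: (@cmeasurable_val R).
by move=> z; case: (abs_val z).
Qed.

(** Dominated convergence, in the form that transfers vanishing integrals. *)
Lemma Rintegral_lim0 (a_ : nat -> circle R -> R) a b :
  (forall n, measurable_fun setT (a_ n)) -> (forall n z, `|a_ n z| <= 1) ->
  (forall z, a_ n z @[n --> \oo] --> a z) -> m.-integrable setT (EFin \o b) ->
  (forall n, \int[m]_z (a_ n z * b z) = 0) -> \int[m]_z (a z * b z) = 0.
Proof.
move=> ma a1 aa ib ab0.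
have mb : measurable_fun setT b by exact/measurable_EFinP/(measurable_int m).
have iab n : m.-integrable setT (EFin \o (fun z => a_ n z * b z)).
  apply: (@integrable_dom _ _ (fun z => `|b z|)) => //.
  - exact: measurable_funM.
  - by move=> z; rewrite normrM ler_piMl.
  - exact: (integrable_norm ib).
have ma' : measurable_fun setT a by exact: (measurable_fun_cvg ma).
have [] := @dominated_convergence _ _ R m setT measurableT
  (fun n z => (a_ n z * b z)%:E) (fun z => (a z * b z)%:E)
  (fun z => `|b z|%:E).
- by move=> n; apply/measurable_EFinP; exact: measurable_funM.
- by apply/measurable_EFinP; exact: measurable_funM.
- apply: nearW => z _; apply: cvg_EFin; first exact: nearW.
  apply: cvgM; [exact: aa|exact: cvg_cst].
- exact: (integrable_norm ib).
- apply: nearW => z n _; rewrite /= lee_fin normrM ler_piMl//.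
move=> _ _ /= cv; rewrite /Rintegral -(cvg_lim _ cv)//.
rewrite (_ : (fun n => _) = fun=> 0%E) ?lim_cst//.
apply/funext => n; rewrite -[RHS]/((0 : R)%:E) -(ab0 n) /Rintegral fineK//.
exact: (integrable_fin_num _ (iab n)).
Qed.

Lemma multiplier_lim (a_ : nat -> circle R -> R) a :
  (forall n, multiplier (a_ n)) -> (forall n z, `|a_ n z| <= 1) ->
  (forall z, a_ n z @[n --> \oo] --> a z) -> multiplier a.
Proof.
move=> Ma a1 aa.
have ma n : measurable_fun setT (a_ n) by case: (Ma n).
split.
- exact: (measurable_fun_cvg ma).
- exists 1 => z; apply: (cvgr_to_le (cvg_norm (aa z))).
  by apply: nearW => n; exact: a1.
- move=> f fn n; have [fi fz] := fourier_null_valX n fn.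
  have [f1 f2] := fi.
  have h k : cintegral (fun z => (a_ k z)%:C%C * (f z * val z ^ n)) = 0.
    case: (Ma k) => _ _ /(_ f fn n) <-; apply: eq_cintegral => z.
    by rewrite mulrA.
  apply: complex_ext => /=.
    rewrite -[RHS](@Rintegral_lim0 a_ a (fun z => Re (f z * val z ^ n)))//.
      by apply: eq_Rintegral => z _; rewrite -mulrA reim /= mul0r subr0.
    move=> k; have /(congr1 (@complex.Re R))/= <- := h k.
    by apply: eq_Rintegral => z _; rewrite [in RHS]reim /= mul0r subr0.
  rewrite -[RHS](@Rintegral_lim0 a_ a (fun z => Im (f z * val z ^ n)))//.
    by apply: eq_Rintegral => z _; rewrite -mulrA reim /= mul0r addr0.
  move=> k; have /(congr1 (@complex.Im R))/= <- := h k.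
  by apply: eq_Rintegral => z _; rewrite [in RHS]reim /= mul0r addr0.
Qed.

(** The indicator of a half-plane is a bounded limit of polynomials in a
    multiplier, through the step polynomials. *)
Lemma multiplier_gt a (c : R) : multiplier a -> (forall z, `|a z| <= 1) ->
  multiplier (\1_[set z | c < a z]).
Proof.
move=> Ma a1.
(* an affine rescaling of [-1, 1] into [0, 1] that sends c to 1/2 *)
pose K := 2 * (1 + `|c|); have K0 : 0 < K by rewrite mulr_gt0// ltr_pwDl.
pose t z := (2^-1 + c / K) + - K^-1 * a z.
have tE z : t z = 2^-1 + (c - a z) / K by rewrite /t; field; rewrite gt_eqF.
have t01 z : 0 <= t z <= 1.
  have h : `|(c - a z) / K| <= 2^-1.
    rewrite normrM normfV (gtr0_norm K0) ler_pdivrMr// /K mulKf//.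
    by rewrite (le_trans (ler_normB _ _))// addrC lerD.
  by rewrite tE; move: h; rewrite ler_norml => /andP[h1 h2]; apply/andP; split; lra.
have tlt z : (t z < 2^-1) = (c < a z).
  rewrite tE -[ltRHS]addr0 ltrD2l pmulr_llt0 ?invr_gt0//.
  by rewrite subr_lt0.
apply: (@multiplier_lim (fun n z => step_poly n (t z))).
- move=> n; apply: multiplierX.
  under [X in multiplier X]eq_fun do rewrite -mulN1r.
  apply: multiplier_affine; apply: multiplierX; exact: multiplier_affine.
- move=> n z; have /andP[h0 h1] := step_poly_bounds n (t01 z).
  by rewrite ger0_norm.
- move=> z; have := cvg_step_poly (t01 z); rewrite tlt.
  rewrite indicE (_ : (z \in _) = (c < a z))//.
  by apply/idP/idP; rewrite inE.
Qed.

Definition multiplier_set (A : set (circle R)) := multiplier (\1_A).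

Lemma multiplier_setC A : multiplier_set A -> multiplier_set (~` A).
Proof.
move=> h; rewrite /multiplier_set.
rewrite (_ : \1_(~` A) = fun z => 1 + -1 * \1_A z); first exact: multiplier_affine.
by apply/funext => z; rewrite !indicE in_setC; case: (_ \in _) => /=; ring.
Qed.

Lemma multiplier_setI A B : multiplier_set A -> multiplier_set B ->
  multiplier_set (A `&` B).
Proof.
move=> hA hB; rewrite /multiplier_set.
rewrite (_ : \1_(A `&` B) = fun z => \1_A z * \1_B z); first exact: multiplierM.
by apply/funext => z; rewrite !indicE in_setI; do 2 case: (_ \in _) => /=; ring.
Qed.

Lemma multiplier_set_bigcap (F : nat -> set (circle R)) :
  (forall n, multiplier_set (F n)) -> multiplier_set (\bigcap_n F n).
Proof.
move=> MF.
pose G n := \bigcap_(k in [set k | (k < n)%N]) F k.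
have MG n : multiplier_set (G n).
  elim: n => [|n ih].
    rewrite /G (_ : [set k | _] = set0) ?bigcap_set0; last first.
      by apply/seteqP; split => k.
    by rewrite /multiplier_set indicT; exact: multiplier_cst.
  rewrite (_ : G n.+1 = G n `&` F n); first exact: multiplier_setI.
  apply/seteqP; split => z /=.
    by move=> h; split => [k /= kn|]; apply: h => //=; exact: ltnW.
  move=> [h1 h2] k /=; rewrite ltnS leq_eqVlt => /predU1P[->//|]; exact: h1.
apply: (@multiplier_lim (fun n => \1_(G n))) => //.
  by move=> n z; rewrite indicE; case: (_ \in _); rewrite ?normr1 ?normr0.
move=> z; apply: cvg_near_cst.
have [zF|zF] := pselect ((\bigcap_n F n) z).
  apply: nearW => n; rewrite !indicE !mem_set// => k _; exact: zF.
have [k zk] : exists k, ~ F k z.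
  by apply/existsNP => h; apply: zF => k _; exact: h.
exists k.+1 => // n /= kn; rewrite !indicE !memNset// => h.
by apply: zk; apply: h.
Qed.

(** Complements come from the affine structure, finite intersections from
    products, countable ones from bounded limits. *)
Lemma sigma_algebra_multiplier_set : sigma_algebra setT multiplier_set.
Proof.
have MC := multiplier_setC; split.
- by rewrite /multiplier_set indic0; exact: multiplier_cst.
- by move=> A hA; rewrite setTD; exact: MC.
- move=> F hF; rewrite -[X in multiplier_set X]setCK setC_bigcup; apply: (MC).
  by apply: multiplier_set_bigcap => n; exact: MC.
Qed.

Lemma multiplier_preimage d (T : measurableType d) (h : circle R -> T)
    (S : set (set T)) : (@measurable d T = <<s S >>) ->
  (forall B, S B -> multiplier_set (h @^-1` B)) ->
  forall B, measurable B -> multiplier_set (h @^-1` B).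
Proof.
move=> -> SB B; move: B; apply: smallest_sub => // {SB}.
have [s0 sC sU] := sigma_algebra_multiplier_set; split.
- by rewrite /= preimage_set0.
- by move=> A hA; rewrite /= setTD preimage_setC -setTD; exact: sC.
- by move=> F hF; rewrite /= preimage_bigcup; exact: sU.
Qed.

(** The Borel sets of the circle are generated by half-planes parallel to the
    axes, because its sigma-algebra is the trace of that of the plane. *)
Lemma measurable_multiplier_set (A : set (circle R)) : measurable A ->
  multiplier_set A.
Proof.
have ray (x : circle R -> R) : multiplier x -> (forall z, `|x z| <= 1) ->
    forall B, measurable B -> multiplier_set (x @^-1` B).
  move=> Mx x1; apply: (multiplier_preimage (@RGenOInfty.measurableE R)).
  move=> _ [c ->]; rewrite (_ : _ @^-1` _ = [set z | c < x z]).
    exact: multiplier_gt.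
  by apply/seteqP; split => z /=; rewrite in_itv /= andbT.
move=> [B mB <-]; rewrite setTI; move: B mB.
apply: (multiplier_preimage (measurable_prod_measurableType _ _)).
move=> _ [A1 mA1 [A2 mA2 <-]]; apply: multiplier_setI.
  by apply: (ray _ multiplier_Re) => // z; case: (abs_val z).
by apply: (ray _ multiplier_Im) => // z; case: (abs_val z).
Qed.

Lemma ae_eq0_Rintegral a : m.-integrable setT (EFin \o a) ->
  (forall A, measurable A -> \int[m]_z (\1_A z * a z) = 0) ->
  \forall z \ae m, a z = 0.
Proof.
move=> ia h; have : ae_eq m setT (EFin \o a) (cst 0%E).
  apply: integral_ae_eq => //.
  move=> E _ mE; rewrite integral0 -[RHS]/((0 : R)%:E) -(h E mE) /Rintegral.
  rewrite integral_mkcond fineK.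
    by apply: eq_integral => z _; rewrite patchE indicE /=; case: ifPn;
      rewrite ?mul1r ?mul0r.
  apply: (integrable_fin_num measurableT).
  apply: (integrable_dom _ _ (integrable_norm ia)).
    apply: measurable_funM; first exact: measurable_indic.
    exact/measurable_EFinP/(measurable_int m).
  by move=> z; rewrite /= normrM ler_piMl// indicE; case: (_ \in _);
    rewrite ?normr1 ?normr0.
by apply: filterS => z /(_ I)[].
Qed.

(** Indicators being multipliers, the integral of [f] over every measurable set
    is 0. *)
Lemma fourier_null_ae0 f : fourier_null f -> \forall z \ae m, f z = 0.
Proof.
move=> fn; have [[f1 f2] _] := fn.
have h A : measurable A -> cintegral (fun z => (\1_A z)%:C%C * f z) = 0.
  move=> /measurable_multiplier_set[_ _ /(_ f fn 0) <-].
  by apply: eq_cintegral => z; rewrite expr0z mulr1.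
have Re0 := ae_eq0_Rintegral f1; have Im0 := ae_eq0_Rintegral f2.
have {}Re0 : \forall z \ae m, Re (f z) = 0.
  apply: Re0 => A /h/(congr1 (@complex.Re R)) /= <-; apply: eq_Rintegral => z _.
  by rewrite [in RHS]reim /= mul0r subr0.
have {}Im0 : \forall z \ae m, Im (f z) = 0.
  apply: Im0 => A /h/(congr1 (@complex.Im R)) /= <-; apply: eq_Rintegral => z _.
  by rewrite [in RHS]reim /= mul0r addr0.
by apply: filterS2 Re0 Im0 => z r0 i0; apply: complex_ext.
Qed.

End uniqueness.

(** * Integrals of the characters *)

Section orthogonality.
Variable R : realType.
Local Notation m := (arc_length R).

Lemma Rintegral_antiderivative (g : circle R -> R) (F : R -> R) :
  measurable_fun setT g -> (forall z, 0 <= g z) ->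
  (forall t : R, is_derive t 1 F (g (expi t))) ->
  continuous (fun t : R => g (expi t)) ->
  \int[m]_z g z = (F (2 * pi) - F 0) / (2 * pi).
Proof.
move=> mg g0 dF cg; rewrite /Rintegral /arc_length ge0_integral_distribution//.
- rewrite integral_uniform//=; last 2 first.
  + apply/measurable_EFinP; exact: continuous_measurable_fun.
  + by move=> t; rewrite lee_fin.
  rewrite (@continuous_FTC2 _ (fun t => g (expi t)) F)//.
  + by rewrite subr0 -EFinB -EFinM /= mulrC.
  + by rewrite twopi_gt0.
  + exact: continuous_subspaceT.
  + have cF : continuous F.
      move=> t; apply: differentiable_continuous; apply/derivable1_diffP.
      by have [] := dF t.
    split => [t _||]; first by have [] := dF t.
      apply: cvg_at_right_filter; exact: cF.
    apply: cvg_at_left_filter; exact: cF.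
  + by move=> t _; rewrite derive1E; have [] := dF t.
- exact/measurable_EFinP.
Qed.

Lemma expiX (t : R) n :
  val (expi t) ^+ n = Complex (cos (n%:R * t)) (sin (n%:R * t)).
Proof.
elim: n => [|n ih]; first by rewrite mul0r cos0 sin0.
rewrite exprS ih -natr1 mulrDl mul1r addrC cosD sinD /=.
by apply: complex_ext => /=; ring.
Qed.

Lemma trig_period (n : nat) :
  cos (n%:R * (2 * pi)) = 1 :> R /\ sin (n%:R * (2 * pi)) = 0 :> R.
Proof.
have -> : n%:R * (2 * pi) = 0 + (pi *+ 2) *+ n :> R.
  by rewrite add0r -[pi *+ 2]mulr_natl -[RHS]mulr_natl.
by rewrite (periodicn (@cosD2pi R)) (periodicn (@sinD2pi R)) cos0 sin0.
Qed.

(** Adding 1 to cos(nt) and sin(nt) makes the integrands nonnegative, so that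
    their integrals transfer to the interval and are given by antiderivatives
    there. *)
Lemma integral_valX_pos (n : nat) : (0 < n)%N ->
  cintegral (fun z : circle R => val z ^ n) = 0.
Proof.
move=> n0; have nR : n%:R != 0 :> R by rewrite pnatr_eq0 -lt0n.
have p0 : 2 * pi != 0 :> R by rewrite gt_eqF// twopi_gt0.
have [c1 s0] := trig_period n.
have [mR mI] := @cmeasurable_valX R n.
have [iR iI] : cintegrable (fun z : circle R => val z ^ n).
  by apply: (@cintegrable_bdd _ _ 1) => // z; rewrite nsq_valX.
have bd (z : circle R) : `|Re (val z ^ n)| <= 1 /\ `|Im (val z ^ n)| <= 1.
  have := nsq_valX z n; rewrite /nsq !ler_norml => h.
  by split; apply/andP; split; nra.
have dm (t : R) : is_derive t (1 : R) (fun t : R => n%:R * t) n%:R.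
  have h : is_derive t (1 : R) (n%:R \*: (@id R)) (n%:R *: (1 : R)).
    exact: is_deriveZ.
  by apply: is_derive_eq h _; rewrite /GRing.scale /= mulr1.
have dsin (t : R) : is_derive t (1 : R) (fun t : R => sin (n%:R * t))
    (cos (n%:R * t) * n%:R).
  exact: (@is_derive1_comp _ (@sin R) (fun t => n%:R * t)).
have dcos (t : R) : is_derive t (1 : R) (fun t : R => cos (n%:R * t))
    (- sin (n%:R * t) * n%:R).
  exact: (@is_derive1_comp _ (@cos R) (fun t => n%:R * t)).
have csin : continuous (fun t : R => sin (n%:R * t)).
  by move=> t; apply/differentiable_continuous/derivable1_diffP; have [] := dsin t.
have ccos : continuous (fun t : R => cos (n%:R * t)).
  by move=> t; apply/differentiable_continuous/derivable1_diffP; have [] := dcos t.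
have shift (g : circle R -> R) : m.-integrable setT (EFin \o g) ->
    \int[m]_z (1 + g z) = 1 -> \int[m]_z g z = 0.
  move=> ig; rewrite RintegralD//; last exact: integrableR_cst.
  rewrite Rintegral_cst// [X in fine X](@probability_setT _ _ _ m) mulr1 => h.
  by apply: (addrI 1); rewrite h addr0.
apply: complex_ext => /=; apply: shift => //.
  have d (t : R) : is_derive t (1 : R) (fun t => t + n%:R^-1 * sin (n%:R * t))
      (1 + Re (val (expi t) ^ n)).
    have h : is_derive t (1 : R) (@id R + n%:R^-1 \*: (fun t => sin (n%:R * t)))
        (1 + n%:R^-1 *: (cos (n%:R * t) * n%:R)).
      by apply: is_deriveD; exact: is_deriveZ.
    apply: is_derive_eq h _.
    by rewrite /GRing.scale -exprnP expiX /= mulrCA mulVf// mulr1.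
  rewrite (Rintegral_antiderivative _ _ d).
  - by rewrite s0 !mulr0 sin0 !mulr0 !addr0 subr0 divff.
  - exact: measurable_funD.
  - by move=> z; have [] := bd z; rewrite ler_norml => /andP[h _] _; lra.
  - rewrite (_ : (fun _ => _) = (fun t : R => 1 + cos (n%:R * t))); last first.
      by apply/funext => t; rewrite -exprnP expiX.
    by move=> t; apply: cvgD; [exact: cvg_cst|exact: ccos].
have d (t : R) : is_derive t (1 : R) (fun t => t - n%:R^-1 * cos (n%:R * t))
    (1 + Im (val (expi t) ^ n)).
  have h : is_derive t (1 : R) (@id R - n%:R^-1 \*: (fun t => cos (n%:R * t)))
      (1 - n%:R^-1 *: (- sin (n%:R * t) * n%:R)).
    by apply: is_deriveB; exact: is_deriveZ.
  apply: is_derive_eq h _.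
  by rewrite /GRing.scale -exprnP expiX /= mulrCA mulVf// mulr1 opprK.
rewrite (Rintegral_antiderivative _ _ d).
- by rewrite c1 mulr0 cos0 sub0r opprK subrK divff.
- exact: measurable_funD.
- by move=> z; have [_] := bd z; rewrite ler_norml => /andP[h _]; lra.
- rewrite (_ : (fun _ => _) = (fun t : R => 1 + sin (n%:R * t))); last first.
    by apply/funext => t; rewrite -exprnP expiX.
  by move=> t; apply: cvgD; [exact: cvg_cst|exact: csin].
Qed.

Lemma integral_valX (n : int) : n != 0 ->
  cintegral (fun z : circle R => val z ^ n) = 0.
Proof.
case: n => n n0; first by apply: integral_valX_pos; rewrite lt0n.
rewrite -[RHS]conjc0 -(@integral_valX_pos n.+1)// -cintegralJ.
  by apply: eq_cintegral => z; rewrite conjc_exprz ?nsq_val// NegzE.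
by apply: (@cintegrable_bdd _ _ 1) => [|z]; [exact: cmeasurable_valX|rewrite nsq_valX].
Qed.

End orthogonality.

(** * Completeness of L^2 *)

Section L2_complete.
Context d (T : measurableType d) (R : realType).
Variable mu : {measure set T -> \bar R}.

Lemma limn_einf_le (u : nat -> \bar R) (c : \bar R) k :
  (forall j, (k <= j)%N -> (u j <= c)%E) -> (limn_einf u <= c)%E.
Proof.
move=> uc; rewrite limn_einf_lim; apply: lime_le; first exact: is_cvg_einfs.
apply: nearW => n; apply: (@le_trans _ _ (u (maxn n k))).
  by apply: ereal_inf_lbound; exists (maxn n k) => //=; rewrite leq_maxl.
by apply: uc; rewrite leq_maxr.
Qed.

(** The increments are at most sqrt K / 2^n, hence summable. *)
Lemma cvg_of_geometric (x : nat -> R) (K : R) :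
  (forall n, 4 ^+ n * (x n.+1 - x n) ^+ 2 <= K) -> cvgn x.
Proof.
move=> xK.
have K0 : 0 <= K by apply: le_trans (xK 0); rewrite mul1r sqr_ge0.
suff cs : cvgn (series (telescope x)).
  rewrite (_ : x = (fun n => x 0%N + series (telescope x) n)); last first.
    by apply/funext => n; exact: eq_sum_telescope.
  by apply: is_cvgD => //; exact: is_cvg_cst.
apply: normed_cvg.
apply: (@series_le_cvg _ _ (geometric (Num.sqrt K) 2^-1)) => /=.
- by move=> n; rewrite normr_ge0.
- by move=> n; rewrite mulr_ge0 ?sqrtr_ge0// exprn_ge0.
- move=> n; rewrite -(@ler_pXn2r _ 2)// ?nnegrE ?mulr_ge0 ?sqrtr_ge0 ?exprn_ge0//.
  rewrite real_normK ?num_real// exprMn sqr_sqrtr// /telescope /=.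
  rewrite -exprM mulnC exprM.
  have -> : (2^-1 ^+ 2 : R) = 4^-1 by rewrite expr2; field.
  rewrite exprVn ler_pdivlMr ?exprn_gt0// mulrC; exact: xK.
- by apply: is_cvg_geometric_series; rewrite ger0_norm// invf_lt1// ltr1n.
Qed.

(** The Riesz-Fischer theorem in quantitative form. Weighted by 4^n, the squared
    increments still have a convergent series of integrals, which forces
    pointwise convergence off a null set; the bound passes to the limit by
    Fatou. *)
Lemma L2_complete (f : nat -> T -> R) :
  (forall n, measurable_fun setT (f n)) ->
  (forall k j, (k <= j)%N ->
    (\int[mu]_z ((f j z - f k z) ^+ 2)%:E <= (8^-1 ^+ k)%:E)%E) ->
  exists2 g : T -> R, measurable_fun setT g &
    forall k, (\int[mu]_z ((g z - f k z) ^+ 2)%:E <= (8^-1 ^+ k)%:E)%E.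
Proof.
move=> mf fc.
pose e n z : \bar R := (4 ^+ n * (f n.+1 z - f n z) ^+ 2)%:E.
have e0 n z : (0 <= e n z)%E.
  by rewrite /e lee_fin mulr_ge0 ?sqr_ge0// exprn_ge0.
have msq (g h : T -> R) : measurable_fun setT g -> measurable_fun setT h ->
    measurable_fun setT (fun z => ((g z - h z) ^+ 2)%:E).
  move=> mg mh; apply/measurable_EFinP; apply: measurable_funX.
  exact: measurable_funB.
have me n : measurable_fun setT (e n).
  by rewrite /e; under eq_fun do rewrite EFinM; apply: measurable_funeM; exact: msq.
pose S z := (\sum_(n <oo) e n z)%E.
have mS : measurable_fun setT S.
  rewrite (_ : S = fun z => \sum_(n <oo | n \in xpredT) e n z)%E.
    exact: ge0_emeasurable_sum.
  by apply/funext => z; apply: eq_eseriesl.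
have S0 z : (0 <= S z)%E by exact: nneseries_ge0.
have iS : mu.-integrable setT S.
  apply/integrableP; split => //.
  under eq_integral => z _ do rewrite gee0_abs//.
  rewrite integral_nneseries//.
  apply: (@le_lt_trans _ _ (\sum_(n <oo) (2 / (2 ^ (n + 1))%:R)%:E)%E).
    apply: lee_nneseries => n _; first by move=> _; exact: integral_ge0.
    rewrite /e; under eq_integral do rewrite EFinM.
    rewrite ge0_integralZl//; last 2 first.
      exact: msq.
      by move=> z _; rewrite lee_fin sqr_ge0.
    apply: (@le_trans _ _ ((4 ^+ n)%:E * (8^-1 ^+ n)%:E)%E).
      by rewrite lee_pmul2l// ?lte_fin ?exprn_gt0//; exact: fc.
    rewrite -EFinM lee_fin -exprMn addn1 expnS natrM invfM mulrA divff// mul1r.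
    have -> : (4 * 8^-1 : R) = 2^-1 by field.
    by rewrite exprVn natrX.
  have := cvg_lim _ (@cvg_geometric_eseries_half R 2 0).
  rewrite /eseries /= => ->//; exact: ltry.
have cS z : S z \is a fin_num -> cvgn (f ^~ z).
  move=> Sz; apply: (@cvg_of_geometric _ (fine (S z))) => n.
  rewrite -lee_fin fineK//.
  apply: (@le_trans _ _ (\sum_(0 <= i < n.+1) e i z)%E).
    by rewrite big_nat_recr//= leeDr// sume_ge0.
  exact: nneseries_lim_ge.
pose g z := fine (limn_esup (fun n => (f n z)%:E)).
have mg : measurable_fun setT g.
  apply: measurableT_comp => //.
  by apply: measurable_fun_limn_esup => n; exact/measurable_EFinP.
exists g => // k.
have gS z : S z \is a fin_num -> f n z @[n --> \oo] --> g z.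
  move=> Sz; have := cS z Sz => /cvg_ex[l fl].
  rewrite (_ : g z = l)// /g.
  have fl' : (f n z)%:E @[n --> \oo] --> l%:E by apply: cvg_EFin => //; exact: nearW.
  by rewrite (cvg_limn_einf_sup fl').2.
have -> : (\int[mu]_z ((g z - f k z) ^+ 2)%:E)%E =
    (\int[mu]_z (limn_einf (fun j => ((f j z - f k z) ^+ 2)%:E)))%E.
  apply: ge0_ae_eq_integral => //; first exact: msq.
  - under eq_fun do rewrite -[limn_einf _]oppeK -limn_esupN.
    apply: measurableT_comp => //; apply: measurable_fun_limn_esup => j /=.
    apply/(@measurable_EFinP _ _ _ _ (fun z => - (f j z - f k z) ^+ 2)).
    by apply: measurable_funN; apply: measurable_funX; exact: measurable_funB.
  - by move=> z _; rewrite lee_fin sqr_ge0.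
  - move=> z _; rewrite limn_einf_lim; apply: lime_ge; first exact: is_cvg_einfs.
    apply: nearW => n; apply: le_ereal_inf_tmp => _ [j _ <-].
    by rewrite lee_fin sqr_ge0.
  - apply: filterS (integrable_ae measurableT iS) => z /(_ I) Sz _.
    have h : ((f j z - f k z) ^+ 2)%:E @[j --> \oo] --> ((g z - f k z) ^+ 2)%:E.
      apply: cvg_EFin; first exact: nearW.
      under eq_fun do rewrite /= expr2.
      rewrite expr2; apply: cvgM; apply: cvgB; (exact: gS || exact: cvg_cst).
    by rewrite (cvg_limn_einf_sup h).1.
apply: le_trans (fatou _ _ _ _) _ => //.
- by move=> j; exact: msq.
- by move=> j z _; rewrite lee_fin sqr_ge0.
- by apply: limn_einf_le (fc k).
Qed.

End L2_complete.

(** * The inner product of L^2 on the circle *)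

Section L2.
Variable R : realType.
Local Notation m := (arc_length R).
Local Notation C := R[i].
Local Notation L2 := (cLp 2%:E).
Implicit Types f g h w : circle R -> C.

Definition sqnorm f : R := \int[m]_z nsq (f z).

Lemma cLnorm2E f : cLnorm 2%:E f = ((\int[m]_z (nsq (f z))%:E) `^ 2^-1)%E.
Proof.
rewrite /cLnorm unlock /=; congr (_ `^ _)%E; apply: eq_integral => z _ /=.
by rewrite powR_mulrn ?normr_ge0// real_normK ?num_real// normc_sqr.
Qed.

Lemma L2P f : L2 f <->
  cmeasurable f /\ m.-integrable setT (EFin \o (fun z => nsq (f z))).
Proof.
have ge0 : (0 <= \int[m]_z (nsq (f z))%:E)%E.
  by apply: integral_ge0 => z _; rewrite lee_fin nsq_ge0.
have absE : (\int[m]_z `|(EFin \o (fun z => nsq (f z))) z|)%E =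
    (\int[m]_z (nsq (f z))%:E)%E.
  by apply: eq_integral => z _ /=; rewrite ger0_norm// nsq_ge0.
split=> [[mf fi]|[mf /integrableP[_]]].
  split => //; apply/integrableP; split.
    exact/measurable_EFinP/measurable_nsq.
  rewrite absE; have := poweR_lty 2 fi.
  rewrite cLnorm2E -poweRrM// mulVf// poweRe1//.
by rewrite absE => fi; split => //; rewrite cLnorm2E poweR_lty.
Qed.

Lemma L2_meas f : L2 f -> cmeasurable f. Proof. by case. Qed.

Lemma L2_int f : L2 f -> m.-integrable setT (EFin \o (fun z => nsq (f z))).
Proof. by case/L2P. Qed.

Lemma sqnormE f : L2 f -> (\int[m]_z (nsq (f z))%:E)%E = (sqnorm f)%:E.
Proof.
by move=> /L2_int fi; rewrite /sqnorm /Rintegral fineK//; exact: (integrable_fin_num _ fi).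
Qed.

Lemma sqnorm_ge0 f : 0 <= sqnorm f.
Proof. by apply: Rintegral_ge0 => z _; exact: nsq_ge0. Qed.

Lemma cLnorm2_sqnorm f : L2 f -> cLnorm 2%:E f = (sqnorm f `^ 2^-1)%:E.
Proof. by move=> Lf; rewrite cLnorm2E sqnormE. Qed.

Lemma cLnorm2_eq f g : L2 f -> L2 g ->
  cLnorm 2%:E f = cLnorm 2%:E g <-> sqnorm f = sqnorm g.
Proof.
move=> Lf Lg; rewrite !cLnorm2_sqnorm//; split=> [[]|->//].
move=> /(congr1 (fun x => x `^ 2)); rewrite -!powRrM mulVf// !powRr1//;
  exact: sqnorm_ge0.
Qed.

Lemma L2_dom f (b : circle R -> R) : cmeasurable f ->
  m.-integrable setT (EFin \o b) -> (\forall z \ae m, nsq (f z) <= b z) -> L2 f.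
Proof.
move=> mf ib fb; apply/L2P; split => //; apply: ae_integrable ib _.
  exact: measurable_nsq.
by apply: filterS fb => z; rewrite ger0_norm// nsq_ge0.
Qed.

Lemma L2D f g : L2 f -> L2 g -> L2 (f \+ g).
Proof.
move=> Lf Lg; have mf := L2_meas Lf; have mg := L2_meas Lg.
apply: (@L2_dom _ (fun z => 2 * nsq (f z) + 2 * nsq (g z))).
- exact: cmeasurableD.
- by apply: integrableRD; apply: integrableRZ; exact: L2_int.
- by apply: nearW => z; exact: le_nsqD.
Qed.

Lemma L2_bmul w f (M : R) : cmeasurable w -> (\forall z \ae m, nsq (w z) <= M) ->
  L2 f -> L2 (w \* f).
Proof.
move=> mw wM Lf; apply: (@L2_dom _ (fun z => M * nsq (f z))).
- by apply: cmeasurableM => //; exact: L2_meas.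
- by apply: integrableRZ; exact: L2_int.
- by apply: filterS wM => z wM; rewrite nsqM ler_wpM2r// nsq_ge0.
Qed.

Lemma L2Z (c : C) f : L2 f -> L2 (fun z => c * f z).
Proof.
move=> Lf; apply: (@L2_bmul (fun=> c) f (nsq c)) => //.
exact: nearW.
Qed.

Lemma L2N f : L2 f -> L2 (\- f).
Proof.
move=> /(L2Z (-1)) h; rewrite (_ : \- f = (fun z => -1 * f z))//.
by apply/funext => z /=; rewrite mulN1r.
Qed.

Lemma L2B f g : L2 f -> L2 g -> L2 (f \- g).
Proof. by move=> Lf /L2N; exact: L2D. Qed.

Lemma L2_bdd f (M : R) : cmeasurable f -> (\forall z \ae m, nsq (f z) <= M) ->
  L2 f.
Proof.
by move=> mf fM; apply: (@L2_dom _ (fun=> M)) => //; exact: integrableR_cst.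
Qed.

Lemma L2_valX (n : int) : L2 (fun z : circle R => val z ^ n).
Proof.
apply: (@L2_bdd _ 1); first exact: cmeasurable_valX.
by apply: nearW => z; rewrite nsq_valX.
Qed.

Lemma L2_cst (c : C) : L2 (fun=> c).
Proof. by apply: (@L2_bdd _ (nsq c)); [exact: cmeasurable_cst|exact: nearW]. Qed.

Lemma sqnorm_bmul_le w f : cmeasurable w -> (\forall z \ae m, nsq (w z) <= 1) ->
  L2 f -> sqnorm (w \* f) <= sqnorm f.
Proof.
move=> mw w1 Lf; have Lwf := L2_bmul mw w1 Lf.
rewrite -lee_fin -!sqnormE//; apply: ae_ge0_le_integral => //.
- by move=> z _; rewrite lee_fin nsq_ge0.
- exact/measurable_EFinP/measurable_nsq/(L2_meas Lwf).
- by move=> z _; rewrite lee_fin nsq_ge0.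
- exact/measurable_EFinP/measurable_nsq/(L2_meas Lf).
- by apply: filterS w1 => z w1 _; rewrite lee_fin nsqM ler_piMl// nsq_ge0.
Qed.

Lemma sqnorm_ae f g : cmeasurable f -> cmeasurable g ->
  (\forall z \ae m, nsq (f z) = nsq (g z)) -> sqnorm f = sqnorm g.
Proof. by move=> mf mg; apply: ae_eq_Rintegral; exact: measurable_nsq. Qed.

Lemma L2_ae f g : L2 f -> cmeasurable g -> (\forall z \ae m, f z = g z) -> L2 g.
Proof.
move=> Lf mg fg; apply: L2_dom (L2_int Lf) _ => //.
by apply: filterS fg => z ->.
Qed.

Lemma Rintegral_eq0_ae (a : circle R -> R) : (\forall z \ae m, 0 <= a z) ->
  m.-integrable setT (EFin \o a) -> \int[m]_z a z = 0 ->
  \forall z \ae m, a z = 0.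
Proof.
move=> a0 ia ia0; have ma := measurable_int m ia.
have : (\int[m]_z `|(a z)%:E| = 0)%E.
  transitivity (\int[m]_z (a z)%:E)%E.
    apply: ae_eq_integral => //; first exact: (measurableT_comp _ ma).
    by apply: filterS a0 => z a0 _; rewrite gee0_abs.
  rewrite -[LHS]fineK; first by rewrite -[fine _]/(\int[m]_z a z) ia0.
  exact: (integrable_fin_num measurableT ia).
move/(ae_eq_integral_abs m measurableT ma).
by apply: filterS => z /(_ I) [].
Qed.

Lemma sqnorm0_ae f : L2 f -> sqnorm f = 0 -> \forall z \ae m, f z = 0.
Proof.
move=> /L2_int Lf f0.
have n0 : \forall z \ae m, 0 <= nsq (f z) by apply: nearW => z; exact: nsq_ge0.
have := Rintegral_eq0_ae n0 Lf f0.
by apply: filterS => z; exact: nsq_eq0.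
Qed.

Lemma dot_int f g : L2 f -> L2 g -> cintegrable (fun z => f z * conjc (g z)).
Proof.
move=> Lf Lg; have mf := L2_meas Lf; have mg := L2_meas Lg.
apply: (@cintegrable_dom _ _ (fun z => nsq (f z) + nsq (g z))).
- by apply: cmeasurableM => //; exact: cmeasurableJ.
- by move=> z; rewrite -(nsqJ (g z)); exact: abs_ReM_le.
- by move=> z; rewrite -(nsqJ (g z)); exact: abs_ImM_le.
- by apply: integrableRD; exact: L2_int.
Qed.

Lemma dotDl f g h : L2 f -> L2 g -> L2 h ->
  dotL2 (f \+ g) h = dotL2 f h + dotL2 g h.
Proof.
move=> Lf Lg Lh; rewrite /dotL2 -cintegralD; [|exact: dot_int..].
by apply: eq_cintegral => z /=; rewrite mulrDl.
Qed.

Lemma dotZl (c : C) f g : L2 f -> L2 g ->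
  dotL2 (fun z => c * f z) g = c * dotL2 f g.
Proof.
move=> Lf Lg; rewrite /dotL2 -cintegralZ; last exact: dot_int.
by apply: eq_cintegral => z /=; rewrite mulrA.
Qed.

Lemma dotBl f g h : L2 f -> L2 g -> L2 h ->
  dotL2 (f \- g) h = dotL2 f h - dotL2 g h.
Proof.
move=> Lf Lg Lh; rewrite -[in RHS]mulN1r -dotZl// -dotDl//; last exact: L2Z.
by apply: eq_cintegral => z /=; rewrite mulN1r.
Qed.

Lemma dotC f g : L2 f -> L2 g -> dotL2 f g = conjc (dotL2 g f).
Proof.
move=> Lf Lg; rewrite /dotL2 -cintegralJ; last exact: dot_int.
by apply: eq_cintegral => z /=; rewrite rmorphM /= conjcK mulrC.
Qed.

Lemma dotBr f g h : L2 f -> L2 g -> L2 h ->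
  dotL2 h (f \- g) = dotL2 h f - dotL2 h g.
Proof.
move=> Lf Lg Lh; rewrite dotC ?dotBl//; last exact: L2B.
by rewrite (dotC Lh Lf) (dotC Lh Lg) rmorphB.
Qed.

Lemma dotZr (c : C) f g : L2 f -> L2 g ->
  dotL2 f (fun z => c * g z) = conjc c * dotL2 f g.
Proof.
move=> Lf Lg; rewrite dotC ?dotZl//; last exact: L2Z.
by rewrite (dotC Lf Lg) rmorphM.
Qed.

Lemma dot_sqnorm f : dotL2 f f = (sqnorm f)%:C%C.
Proof.
apply: complex_ext => /=.
  by apply: eq_Rintegral => z _; rewrite mulJ_nsq.
rewrite -[RHS]/(fine (0%E : \bar R)) /Rintegral; congr fine.
by rewrite integral0_eq// => z _; rewrite mulJ_nsq.
Qed.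

Lemma ae_eq_dot f g f' g' : cmeasurable f -> cmeasurable g ->
  cmeasurable f' -> cmeasurable g' -> (\forall z \ae m, f z = f' z) ->
  (\forall z \ae m, g z = g' z) -> dotL2 f g = dotL2 f' g'.
Proof.
move=> mf mg mf' mg' ff' gg'; apply: ae_eq_cintegral.
- by apply: cmeasurableM => //; exact: cmeasurableJ.
- by apply: cmeasurableM => //; exact: cmeasurableJ.
- by apply: filterS2 ff' gg' => z -> ->.
Qed.

Lemma sqnormB_dot (t : R) f g : L2 f -> L2 g ->
  sqnorm (f \- (fun z => t%:C%C * dotL2 f g * g z)) =
  sqnorm f - 2 * t * nsq (dotL2 f g) + t ^+ 2 * nsq (dotL2 f g) * sqnorm g.
Proof.
move=> Lf Lg; apply: (@complexI R).
have Lcg : L2 (fun z => t%:C%C * dotL2 f g * g z) by exact: L2Z.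
rewrite -dot_sqnorm dotBl//; last exact: L2B.
rewrite !dotBr// dotZl// !dotZr// !dotZl// !dot_sqnorm (dotC Lg Lf).
set D := dotL2 f g.
by apply: complex_ext; rewrite /nsq !reim /= ?reim /=; ring.
Qed.

(** The choice of the real parameter that minimizes the trinomial; when [b] is 0
    the trinomial is affine and unbounded below unless [D] vanishes. With [e] an
    error term it serves both for Cauchy-Schwarz and for the approximate
    orthogonality of a minimizing sequence. *)
Lemma discriminant_le (e D b : R) : 0 <= e -> 0 <= D -> 0 <= b ->
  (forall t, 0 <= e - 2 * t * D + t ^+ 2 * D * b) -> D <= e * b.
Proof.
move=> e0 D0 b0 h; have [b1|b1] := ltP 0 b.
  have := h b^-1.
  have -> : b^-1 ^+ 2 * D * b = b^-1 * D by field; rewrite gt_eqF.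
  have -> : e - 2 * b^-1 * D + b^-1 * D = e - D / b by field; rewrite gt_eqF.
  by rewrite subr_ge0 ler_pdivrMr.
have b00 : b = 0 by apply/eqP; rewrite eq_le b1 b0.
rewrite b00 mulr0 leNgt; apply/negP => D1.
have := h ((e + 1) / (2 * D)); rewrite b00 mulr0 addr0.
have -> : e - 2 * ((e + 1) / (2 * D)) * D = -1 by field; rewrite gt_eqF.
by rewrite ler0N1.
Qed.

Lemma cauchy_schwarz f g : L2 f -> L2 g ->
  nsq (dotL2 f g) <= sqnorm f * sqnorm g.
Proof.
move=> Lf Lg; apply: discriminant_le; rewrite ?sqnorm_ge0 ?nsq_ge0// => t.
by rewrite -sqnormB_dot// sqnorm_ge0.
Qed.

Lemma sqnorm_parallelogram f g : L2 f -> L2 g ->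
  sqnorm (f \- g) + sqnorm (f \+ g) = 2 * sqnorm f + 2 * sqnorm g.
Proof.
move=> Lf Lg; rewrite /sqnorm -RintegralD//; last 2 first.
- exact: (L2_int (L2B Lf Lg)).
- exact: (L2_int (L2D Lf Lg)).
rewrite -!RintegralZl//; [|exact: L2_int..].
rewrite -RintegralD//; [|by apply: integrableRZ; exact: L2_int..].
by apply: eq_Rintegral => z _; exact: nsq_parallelogram.
Qed.

End L2.

(** * Projection onto the closure of a subspace *)

Section projection.
Variable R : realType.
Local Notation m := (arc_length R).
Local Notation C := R[i].
Local Notation L2 := (cLp 2%:E).
Implicit Types (f g h w : circle R -> C) (V : set (circle R -> C)).

Lemma exists_geometric8_lt (e : R) : 0 < e -> exists k, 8^-1 ^+ k < e.
Proof.
move=> e0; have /cvgrPdist_lt/(_ _ e0)[k _ /(_ k (leqnn k))] : 8^-1 ^+ n @[n --> \oo] --> (0 : R).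
  by apply: cvg_expr; rewrite ger0_norm// invf_lt1// ltr1n.
rewrite /= sub0r normrN ger0_norm ?exprn_ge0// => h; by exists k.
Qed.

Lemma sqnorm_complete (v : nat -> circle R -> C) : (forall k, L2 (v k)) ->
  (forall k j, (k <= j)%N -> sqnorm (v j \- v k) <= 8^-1 ^+ k) ->
  exists p, L2 p /\ forall k, sqnorm (p \- v k) <= 2 * 8^-1 ^+ k.
Proof.
move=> Lv vc.
have mv k : cmeasurable (v k) by exact: L2_meas.
have vcE k j : (k <= j)%N ->
    (\int[m]_z (nsq (v j z - v k z))%:E <= (8^-1 ^+ k)%:E)%E.
  by move=> kj; rewrite (sqnormE (L2B (Lv j) (Lv k))) lee_fin; exact: vc.
have comp (x : C -> R) (xB : forall y y', x (y - y') = x y - x y') :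
    (forall f, cmeasurable f -> measurable_fun setT (fun z => x (f z))) ->
    (forall y, x y ^+ 2 <= nsq y) ->
    exists2 a : circle R -> R, measurable_fun setT a &
    forall k, (\int[m]_z ((a z - x (v k z)) ^+ 2)%:E <= (8^-1 ^+ k)%:E)%E.
  move=> mx xn; apply: (@L2_complete _ _ _ m (fun k z => x (v k z))).
    by move=> k; exact: mx.
  move=> k j kj; apply: le_trans (vcE k j kj); apply: ge0_le_integral => //.
  - by move=> z _; rewrite lee_fin sqr_ge0.
  - apply/measurable_EFinP; apply: measurable_funX.
    by apply: measurable_funB; exact: mx.
  - exact/measurable_EFinP/measurable_nsq/cmeasurableB.
  - by move=> z _; rewrite lee_fin -xB.
have [a ma ac] : exists2 a : circle R -> R, measurable_fun setT a &
    forall k, (\int[m]_z ((a z - Re (v k z)) ^+ 2)%:E <= (8^-1 ^+ k)%:E)%E.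
  apply: (comp (@complex.Re R)); first by move=> y y'; rewrite !reim.
    by move=> f [].
  by move=> y; rewrite /nsq lerDl sqr_ge0.
have [b mb bc] : exists2 a : circle R -> R, measurable_fun setT a &
    forall k, (\int[m]_z ((a z - Im (v k z)) ^+ 2)%:E <= (8^-1 ^+ k)%:E)%E.
  apply: (comp (@complex.Im R)); first by move=> y y'; rewrite !reim.
    by move=> f [].
  by move=> y; rewrite /nsq lerDr sqr_ge0.
pose p z := Complex (a z) (b z).
have mp : cmeasurable p by [].
have pE k : (\int[m]_z (nsq (p z - v k z))%:E <= (2 * 8^-1 ^+ k)%:E)%E.
  have -> : (\int[m]_z (nsq (p z - v k z))%:E =
    \int[m]_z (((a z - Re (v k z)) ^+ 2)%:E + ((b z - Im (v k z)) ^+ 2)%:E))%E.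
    by apply: eq_integral => z _; rewrite /nsq !reim /= EFinD.
  have [mR mI] := mv k.
  rewrite ge0_integralD//.
  - by rewrite mulrDl mul1r EFinD leeD.
  - by move=> z _; rewrite lee_fin sqr_ge0.
  - by apply/measurable_EFinP; apply: measurable_funX; exact: measurable_funB.
  - by move=> z _; rewrite lee_fin sqr_ge0.
  - by apply/measurable_EFinP; apply: measurable_funX; exact: measurable_funB.
have Lpv k : L2 (p \- v k).
  apply/L2P; split; first exact: cmeasurableB.
  apply/integrableP; split; first exact/measurable_EFinP/measurable_nsq/cmeasurableB.
  apply: le_lt_trans (ltry (2 * 8^-1 ^+ k)); apply: le_trans (pE k).
  rewrite le_eqVlt; apply/orP; left; apply/eqP; apply: eq_integral => z _ /=.
  by rewrite ger0_norm// nsq_ge0.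
exists p; split=> [|k]; last by rewrite -lee_fin -(sqnormE (Lpv k)); exact: pE.
rewrite (_ : p = (p \- v 0%N) \+ v 0%N); first exact: L2D.
by apply/funext => z /=; rewrite subrK.
Qed.

Definition linear_subspace V := [/\ V (fun=> 0), forall v, V v -> L2 v &
  forall (c : C) v w, V v -> V w -> V (fun z => v z + c * w z)].

Definition L2_closure V : set (circle R -> C) := [set f | L2 f /\
  forall e : R, 0 < e -> exists2 v, V v & sqnorm (f \- v) < e].

Lemma sqnormZ (c : C) f : L2 f -> sqnorm (fun z => c * f z) = nsq c * sqnorm f.
Proof.
move=> Lf; rewrite /sqnorm -RintegralZl//; last exact: L2_int.
by apply: eq_Rintegral => z _; rewrite nsqM.
Qed.

Lemma le0_geometric8 (x K : R) : 0 <= K -> (forall k, x <= K * 8^-1 ^+ k) -> x <= 0.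
Proof.
move=> K0 h; rewrite leNgt; apply/negP => x0.
have [k] := @exists_geometric8_lt (x / (K + 1)) (divr_gt0 x0 (ltr_wpDl K0 ltr01)).
rewrite ltr_pdivlMr; last by rewrite ltr_wpDl.
have := h k; have : 0 <= (8^-1 ^+ k : R) by rewrite exprn_ge0.
nra.
Qed.

(** The subspace need not be closed, whence the closure: a sequence minimizing
    the distance to [f] is Cauchy by the parallelogram law, and is
    orthogonal to the subspace in the limit. *)
Lemma projection V f : linear_subspace V -> L2 f ->
  exists p, L2_closure V p /\ forall v, V v -> dotL2 (f \- p) v = 0.
Proof.
move=> [V0 VL Vlin] Lf.
pose dist := [set sqnorm (f \- v) | v in V].
have hinf : has_inf dist.
  split; first by exists (sqnorm (f \- (fun=> 0))), (fun=> 0).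
  by exists 0 => _ [v _ <-]; exact: sqnorm_ge0.
have dle v : V v -> inf dist <= sqnorm (f \- v).
  by move=> Vv; apply: ge_inf; [case: hinf|exists v].
have ek0 k : 0 < (8^-1 ^+ k / 4 : R) by rewrite divr_gt0// exprn_gt0.
have /choice[v vP] : forall k, exists v, V v /\
    sqnorm (f \- v) < inf dist + 8^-1 ^+ k / 4.
  move=> k; have [_ [v Vv <-] h] := inf_adherent (ek0 k) hinf.
  by exists v.
have Vv k : V (v k) by case: (vP k).
have Lv k : L2 (v k) by exact: VL.
have Lfv k : L2 (f \- v k) by exact: L2B.
have vc k j : (k <= j)%N -> sqnorm (v j \- v k) <= 8^-1 ^+ k.
  (* the midpoint of v j and v k is no closer to f than the infimum *)
  move=> kj; pose mid z := v j z + 2^-1%:C%C * (v k z - v j z).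
  have Vmid : V mid.
    apply: (Vlin) => //; have := Vlin (-1) _ _ (Vv k) (Vv j).
    by congr V; apply/funext => z; rewrite mulN1r.
  have := sqnorm_parallelogram (Lfv k) (Lfv j).
  have -> : (f \- v k) \- (f \- v j) = v j \- v k.
    by apply/funext => z /=; ring.
  have -> : sqnorm ((f \- v k) \+ (f \- v j)) = 4 * sqnorm (f \- mid).
    rewrite (_ : _ \+ _ = (fun z => 2%:C%C * (f \- mid) z)).
      rewrite sqnormZ ?nsqR; last by apply: L2B => //; exact: VL.
      by congr (_ * _); ring.
    apply/funext => z; rewrite /= /mid.
    by apply: complex_ext; rewrite !reim /= ?reim; field.
  have := dle _ Vmid; have [_ h1] := vP k; have [_ h2] := vP j.
  have : (8^-1 ^+ j : R) <= 8^-1 ^+ k.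
    by rewrite ler_wiXn2l// invf_le1// ler1n.
  lra.
have [p [Lp pc]] := sqnorm_complete Lv vc.
exists p; split.
  split=> // e e0; have [k ke] := @exists_geometric8_lt (e / 2) (divr_gt0 e0 (ltr0Sn R 1)).
  exists (v k) => //; apply: le_lt_trans (pc k) _; lra.
move=> w Vw; have Lw := VL _ Vw.
have fvw k : nsq (dotL2 (f \- v k) w) <= 8^-1 ^+ k / 4 * sqnorm w.
  apply: discriminant_le; rewrite ?nsq_ge0 ?sqnorm_ge0 ?(ltW (ek0 k))// => t.
  have := sqnormB_dot t (Lfv k) Lw.
  set c := t%:C%C * dotL2 _ _.
  have -> : (f \- v k) \- (fun z => c * w z) = f \- (fun z => v k z + c * w z).
    by apply/funext => z /=; ring.
  have := dle _ (Vlin c _ _ (Vv k) Vw); have [_ h] := vP k.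
  move=> h1 h2; rewrite h2 in h1; lra.
apply: nsq_eq0; apply/eqP; rewrite eq_le nsq_ge0 andbT.
apply: (@le0_geometric8 _ (5 * sqnorm w)) => [|k]; first by rewrite mulr_ge0// sqnorm_ge0.
have -> : dotL2 (f \- p) w = dotL2 (f \- v k) w - dotL2 (p \- v k) w.
  rewrite -dotBl//; last exact: L2B.
  by congr dotL2; apply/funext => z /=; ring.
apply: le_trans (le_nsqD _ _) _; rewrite nsqN.
have h1 := fvw k.
have h2 : nsq (dotL2 (p \- v k) w) <= 2 * 8^-1 ^+ k * sqnorm w.
  apply: le_trans (cauchy_schwarz (L2B Lp (Lv k)) Lw) _.
  by apply: ler_wpM2r (pc k); exact: sqnorm_ge0.
have h3 : 0 <= 8^-1 ^+ k * sqnorm w by rewrite mulr_ge0 ?exprn_ge0 ?sqnorm_ge0.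
move: h1 h2 h3; set e := 8^-1 ^+ k; set W := sqnorm w; nra.
Qed.

Lemma dot_closure V f g : (forall v, V v -> L2 v) -> L2 g ->
  (forall v, V v -> dotL2 g v = 0) -> L2_closure V f -> dotL2 g f = 0.
Proof.
move=> VL Lg gV [Lf fV].
apply: nsq_eq0; apply/eqP; rewrite eq_le nsq_ge0 andbT.
apply: (@le0_geometric8 _ (sqnorm g)) => [|k]; first exact: sqnorm_ge0.
have [v Vv fv] := fV (8^-1 ^+ k) ltac:(by rewrite exprn_gt0).
have Lv := VL _ Vv.
have -> : dotL2 g f = dotL2 g (f \- v) by rewrite dotBr// (gV v Vv) subr0.
apply: le_trans (cauchy_schwarz Lg (L2B Lf Lv)) _.
by rewrite ler_wpM2l ?sqnorm_ge0// ltW.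
Qed.

End projection.

(** * Hardy space and Beurling's theorem *)

Section Hardy.
Variable R : realType.
Local Notation m := (arc_length R).
Local Notation C := R[i].
Local Notation L2 := (cLp 2%:E).
Implicit Types (f g h w k : circle R -> C) (p q : {poly C}).

Lemma fourierD f g n : L2 f -> L2 g ->
  fourier (f \+ g) n = fourier f n + fourier g n.
Proof. by move=> Lf Lg; apply: dotDl => //; exact: L2_valX. Qed.

Lemma fourierB f g n : L2 f -> L2 g ->
  fourier (f \- g) n = fourier f n - fourier g n.
Proof. by move=> Lf Lg; apply: dotBl => //; exact: L2_valX. Qed.

Lemma fourierZ (c : C) f n : L2 f ->
  fourier (fun z => c * f z) n = c * fourier f n.
Proof. by move=> Lf; apply: dotZl => //; exact: L2_valX. Qed.

Lemma fourier_shift f (k n : int) :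
  fourier (fun z => val z ^ k * f z) n = fourier f (n - k).
Proof.
apply: eq_cintegral => z; rewrite -mulrA mulrCA; congr (_ * _).
rewrite !conjc_exprz ?nsq_val// -expfzDr ?val_neq0//; congr (_ ^ _).
by rewrite opprB.
Qed.

Lemma fourierE f n : fourier f n = cintegral (fun z => f z * val z ^ (- n)).
Proof. by apply: eq_cintegral => z; rewrite conjc_exprz// nsq_val. Qed.

Lemma ae_eq_fourier f g n : cmeasurable f -> cmeasurable g ->
  (\forall z \ae m, f z = g z) -> fourier f n = fourier g n.
Proof.
by move=> mf mg fg; apply: ae_eq_dot => //; [exact: cmeasurable_valX..|exact: nearW].
Qed.

Lemma fourier_cst (c : C) n : n != 0 -> fourier (fun=> c : C) n = 0.
Proof.
move=> n0; rewrite fourierE cintegralZ ?integral_valX ?mulr0 ?oppr_eq0//.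
by apply: (@cintegrable_bdd _ _ 1) => [|z]; [exact: cmeasurable_valX|rewrite nsq_valX].
Qed.

Lemma sqnorm_valX (n : int) : sqnorm (fun z : circle R => val z ^ n) = 1.
Proof.
rewrite /sqnorm; under eq_Rintegral do rewrite nsq_valX.
by rewrite Rintegral_cst// [X in fine X](@probability_setT _ _ _ m) mulr1.
Qed.

Lemma fourier_eq0_ae f : L2 f -> (forall n, fourier f n = 0) ->
  \forall z \ae m, f z = 0.
Proof.
move=> Lf f0; apply: fourier_null_ae0; split=> [|n].
  rewrite (_ : f = fun z => f z * conjc (val z ^ 0)).
    by apply: dot_int => //; exact: L2_valX.
  by apply/funext => z; rewrite expr0z conjc1 mulr1.
by rewrite -[RHS](f0 (- n)) fourierE; apply: eq_cintegral => z; rewrite opprK.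
Qed.

Lemma H2_L2 f : H2 f -> L2 f. Proof. by case. Qed.

Lemma H2_ae f g : H2 f -> cmeasurable g -> (\forall z \ae m, f z = g z) -> H2 g.
Proof.
move=> [Lf fn] mg fg; split; first exact: L2_ae Lf mg fg.
by move=> n n0; rewrite -(@ae_eq_fourier f)// ?fn//; exact: L2_meas.
Qed.

(** Its closure is the cyclic subspace generated by [k] under multiplication by
    z. *)
Definition polyspan k : set (circle R -> C) :=
  [set f | exists p, f = fun z => p.[val z] * k z].

Lemma horner_bdd p : cmeasurable (fun z : circle R => p.[val z]) /\
  exists M, forall z : circle R, nsq p.[val z] <= M.
Proof.
elim/poly_ind: p => [|p c [mp [M pM]]].
  split; last by exists 0 => z; rewrite horner0 nsq0.
  by under [X in cmeasurable X]eq_fun do rewrite horner0; exact: cmeasurable_cst.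
split.
  under [X in cmeasurable X]eq_fun do rewrite hornerMXaddC.
  apply: cmeasurableD; last exact: cmeasurable_cst.
  by apply: cmeasurableM => //; exact: cmeasurable_val.
exists (2 * M + 2 * nsq c) => z; rewrite hornerMXaddC.
apply: le_trans (le_nsqD _ _) _; rewrite nsqM nsq_val mulr1.
by rewrite lerD2r ler_wpM2l.
Qed.

Lemma L2_horner p k : L2 k -> L2 (fun z => p.[val z] * k z).
Proof.
move=> Lk; have [mp [M pM]] := horner_bdd p.
by apply: (L2_bmul mp _ Lk); exact: nearW pM.
Qed.

Lemma polyspan_subspace k : L2 k -> linear_subspace (polyspan k).
Proof.
move=> Lk; split.
- by exists 0; apply/funext => z; rewrite horner0 mul0r.
- by move=> _ [p ->]; exact: L2_horner.
- move=> c _ _ [p ->] [q ->]; exists (p + c *: q); apply/funext => z.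
  by rewrite hornerD hornerZ mulrDl mulrA.
Qed.

Lemma polyspanL2 k f : L2 k -> polyspan k f -> L2 f.
Proof. by move=> /polyspan_subspace[_ h _]; exact: h. Qed.

(** Multiplication by z moves the coefficients up. *)
Lemma fourier_horner p k (N : int) : L2 k ->
  (forall n, n < N -> fourier k n = 0) ->
  forall n, n < N -> fourier (fun z => p.[val z] * k z) n = 0.
Proof.
move=> Lk k0; elim/poly_ind: p => [|p c ih] n nN.
  rewrite (_ : (fun _ => _) = (fun z => 0 * k z)).
    by rewrite fourierZ// mul0r.
  by apply/funext => z; rewrite horner0.
have Lpk := L2_horner p Lk.
have Ls : L2 (fun z => val z ^ 1 * (p.[val z] * k z)).
  apply: (@L2_bmul _ _ _ 1) Lpk; first exact: cmeasurable_valX.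
  by apply: nearW => z; rewrite nsq_valX.
rewrite (_ : (fun _ => _) = (fun z => val z ^ 1 * (p.[val z] * k z)) \+
    (fun z => c * k z)).
  rewrite fourierD ?fourierZ//; last exact: L2Z.
  rewrite (fourier_shift (fun z => p.[val z] * k z)) k0// mulr0 addr0 ih//.
  by rewrite (lt_trans _ nN)// ltrBlDr ltrDl.
by apply/funext => z /=; rewrite hornerMXaddC expr1z mulrDl mulrA [val z * _]mulrC.
Qed.

(** Multiplication by a function bounded by 1 contracts L^2, hence the Fourier
    coefficients of [w \* f] are limits of those of [w \* k] times analytic
    polynomials. *)
Lemma fourier_closure w k f (N : int) : cmeasurable w ->
  (\forall z \ae m, nsq (w z) <= 1) -> L2 k -> L2_closure (polyspan k) f ->
  (forall n, n < N -> fourier (w \* k) n = 0) ->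
  forall n, n < N -> fourier (w \* f) n = 0.
Proof.
move=> mw w1 Lk [Lf fk] wk n nN.
have Lwk : L2 (w \* k) by exact: L2_bmul w1 Lk.
apply: nsq_eq0; apply/eqP; rewrite eq_le nsq_ge0 andbT.
apply: (@le0_geometric8 _ _ 1) => // j; rewrite mul1r.
have [_ [p ->] fv] := fk (8^-1 ^+ j) ltac:(by rewrite exprn_gt0).
have Lv := L2_horner p Lk.
set v := (fun z => p.[val z] * k z) in Lv fv.
have Lfv : L2 (f \- v) by exact: L2B.
have -> : fourier (w \* f) n = fourier (w \* (f \- v)) n.
  rewrite (_ : w \* f = (w \* (f \- v)) \+ (fun z => p.[val z] * (w \* k) z)).
    rewrite fourierD; [|exact: L2_bmul w1 Lfv|exact: L2_horner].
    by rewrite (fourier_horner p Lwk wk)// addr0.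
  by apply/funext => z /=; rewrite /v; ring.
have := cauchy_schwarz (L2_bmul mw w1 Lfv) (L2_valX R n).
rewrite sqnorm_valX mulr1 => /le_trans; apply.
by rewrite (le_trans (sqnorm_bmul_le mw w1 Lfv))// ltW.
Qed.

Lemma H2_closure k f : H2 k -> L2_closure (polyspan k) f -> H2 f.
Proof.
move=> [Lk k0] fk; split => [|n n0]; first by case: fk.
have one g : (fun=> 1 : C) \* g = g by apply/funext => z /=; rewrite mul1r.
rewrite -(one f); apply: (@fourier_closure _ k _ 0) => //.
- by apply: nearW => z; rewrite nsq1.
- by rewrite one.
Qed.

Lemma H2_cst (c : C) : H2 (fun=> c : C).
Proof.
split; first exact: L2_cst.
by move=> n n0; rewrite fourier_cst// lt_eqF.
Qed.

(** [g - P g], where [P] projects onto the closure of the analytic polynomials,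
    has no Fourier coefficients. *)
Lemma H2_closure_poly g : H2 g ->
  exists a : circle R -> C,
    L2_closure (polyspan (fun=> 1)) a /\ \forall z \ae m, a z = g z.
Proof.
move=> [Lg g0]; have L1 := L2_cst (1 : C).
have [p [pc gp]] := projection (polyspan_subspace L1) Lg.
exists p; split => //; have [Lp p0] := H2_closure (H2_cst 1) pc.
have : \forall z \ae m, (g \- p) z = 0.
  apply: fourier_eq0_ae => [|n]; first exact: L2B.
  have [n0|n0] := ltP n 0; first by rewrite fourierB// g0// p0// subrr.
  apply: gp; exists ('X^`|n|%N); apply/funext => z.
  by rewrite hornerXn mulr1 exprnP gez0_abs.
by apply: filterS => z /= /eqP; rewrite subr_eq0 => /eqP.
Qed.

(** True for polynomials [g], and then for their limits. *)
Lemma H2M w g : H2 w -> (\forall z \ae m, nsq (w z) <= 1) -> H2 g -> H2 (w \* g).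
Proof.
move=> [Lw w0] w1 Hg; have [p [pc pg]] := H2_closure_poly Hg.
have mw := L2_meas Lw; have Lp : L2 p by case: pc.
have Hwp : H2 (w \* p).
  split; first exact: L2_bmul w1 Lp.
  apply: (@fourier_closure _ (fun=> 1) _ 0) => //; first exact: L2_cst.
  by rewrite (_ : w \* _ = w)//; apply/funext => z /=; rewrite mulr1.
apply: H2_ae Hwp _ _.
  by apply: cmeasurableM => //; exact/L2_meas/H2_L2.
by apply: filterS pg => z /= ->.
Qed.

Lemma H2_nonneg_fourier f : H2 f -> ~ (\forall z \ae m, f z = 0) ->
  exists2 n : nat, fourier f n != 0 & forall i : int, i < n -> fourier f i = 0.
Proof.
move=> [Lf f0] fn0.
have ex : exists n : nat, fourier f n != 0.
  apply: contrapT => /forallNP h; apply: fn0; apply: fourier_eq0_ae => // n.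
  have [n0|n0] := ltP n 0; first exact: f0.
  by have /negP := h `|n|%N; rewrite negbK gez0_abs// => /eqP.
case: (ex_minnP ex) => n fn nmin; exists n => // i i_n.
have [i0|i0] := ltP i 0; first exact: f0.
apply/eqP; apply: contraTT i_n => fi; rewrite -leNgt -(gez0_abs i0) lez_nat.
by apply: nmin; rewrite gez0_abs.
Qed.

Lemma closure_polyspan_valX k f (j : nat) : L2 k -> L2_closure (polyspan k) f ->
  L2_closure (polyspan (fun z => val z ^ 1 * k z)) (fun z => val z ^ j.+1 * f z).
Proof.
move=> Lk [Lf fk].
have w1 : \forall z \ae m, nsq (val z ^ j.+1) <= 1.
  by apply: nearW => z; rewrite nsq_valX.
have mw := @cmeasurable_valX R j.+1.
split=> [|e e0]; first exact: (L2_bmul mw w1 Lf).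
have [_ [p ->] h] := fk e e0.
exists (fun z => val z ^ j.+1 * (p.[val z] * k z)).
  exists ('X^j * p); apply/funext => z.
  by rewrite hornerM hornerXn -!exprnP exprSr expr1; ring.
apply: le_lt_trans h.
have Lv := L2B Lf (L2_horner p Lk).
apply: le_trans (sqnorm_bmul_le mw w1 Lv).
by rewrite le_eqVlt; apply/predU1P; left; congr sqnorm; apply/funext => z /=; rewrite mulrBr.
Qed.

Lemma L2_closureZ k f (c : C) : L2 k -> c != 0 -> L2_closure (polyspan k) f ->
  L2_closure (polyspan k) (fun z => c * f z).
Proof.
move=> Lk c0 [Lf fk]; split=> [|e e0]; first exact: L2Z.
have nc0 : 0 < nsq c.
  by rewrite lt_neqAle nsq_ge0 andbT eq_sym; apply: contra c0 => /eqP/nsq_eq0 ->.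
have [_ [p ->] h] := fk (e / nsq c) (divr_gt0 e0 nc0).
exists (fun z => (c *: p).[val z] * k z); first by exists (c *: p).
rewrite (_ : _ \- _ = (fun z => c * (f z - p.[val z] * k z))).
  rewrite sqnormZ; last exact: (L2B Lf (L2_horner p Lk)).
  by rewrite mulrC -ltr_pdivlMr.
by apply/funext => z /=; rewrite hornerZ mulrBr mulrA.
Qed.

(** Beurling's argument. The cyclic subspace E of [h] is larger than zE, for the
    first nonzero Fourier coefficient of [h] vanishes on zE. A vector [g] of E
    orthogonal to zE is orthogonal to z^j [g] for positive j; in other words all
    Fourier coefficients of |[g]|^2 but one vanish, and |[g]| is constant. *)
Lemma inner_in_closure h : H2 h -> ~ (\forall z \ae m, h z = 0) ->
  exists2 psi, L2_closure (polyspan h) psi & \forall z \ae m, nsq (psi z) = 1.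
Proof.
move=> Hh hn0; have Lh := H2_L2 Hh.
have [n hn hlt] := H2_nonneg_fourier Hh hn0.
pose zh z := val z ^ 1 * h z.
have Lzh : L2 zh.
  apply: (@L2_bmul _ _ _ 1) Lh; first exact: cmeasurable_valX.
  by apply: nearW => z; rewrite nsq_valX.
have [p [pc hp]] := projection (polyspan_subspace Lzh) Lh.
have [Lp pv] := pc.
pose g := h \- p; have Lg : L2 g by exact: L2B.
have gn : fourier g n != 0.
  rewrite fourierB//; suff -> : fourier p n = 0 by rewrite subr0.
  have one f : (fun=> 1 : C) \* f = f by apply/funext => z /=; rewrite mul1r.
  (* the coefficients of zh vanish up to the index n included *)
  rewrite -(one p); apply: (@fourier_closure _ zh _ n.+1) => //.
  - by apply: nearW => z; rewrite nsq1.
  - by rewrite one => i ilt; rewrite fourier_shift hlt// ltrBlDr addrC -intS.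
  - by rewrite ltz_nat.
have gc : L2_closure (polyspan h) g.
  split=> // e e0; have [_ [q ->] hq] := pv e e0.
  exists (fun z => (1 - q * 'X).[val z] * h z); first by exists (1 - q * 'X).
  apply: le_lt_trans hq; rewrite le_eqVlt; apply/predU1P; left; apply: eq_Rintegral => z _ /=.
  rewrite -nsqN; congr nsq.
  by rewrite hornerD hornerN hornerMX hornerC /g /zh /= expr1z; ring.
have gzg j : dotL2 g (fun z => val z ^ j.+1 * g z) = 0.
  apply: (@dot_closure _ (polyspan zh)) => //.
    by move=> v; exact: polyspanL2.
  exact: closure_polyspan_valX.
pose c := sqnorm g.
have c0 : 0 < c.
  rewrite lt_neqAle sqnorm_ge0 andbT eq_sym; apply/eqP => c0.
  move/eqP: gn; apply.
  rewrite (ae_eq_fourier _ (L2_meas Lg) (cmeasurable_cst (0 * 0))).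
    by rewrite (fourierZ 0)// ?mul0r//; exact: L2_cst.
  by apply: filterS (sqnorm0_ae Lg c0) => z ->; rewrite mul0r.
have gE : \forall z \ae m, nsq (g z) = c.
  (* uniqueness of Fourier coefficients applies to |g|^2 - c *)
  pose F z : C := (nsq (g z))%:C%C - c%:C%C.
  have Fgg : F = (fun z => g z * conjc (g z)) \+ (fun=> - c%:C%C).
    by apply/funext => z; rewrite /F -mulJ_nsq.
  have igg := dot_int Lg Lg.
  have ic (a : C) : cintegrable (fun=> a).
    by apply: (@cintegrable_bdd _ _ (nsq a)) => //; exact: cmeasurable_cst.
  have ggn (j : nat) : cintegral (fun z => g z * conjc (g z) * val z ^ - j.+1%:Z) = 0.
    rewrite -[RHS](gzg j); apply: eq_cintegral => z.
    by rewrite rmorphM /= conjc_exprz ?nsq_val// mulrAC mulrA.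
  have : \forall z \ae m, F z = 0.
    apply: fourier_null_ae0; split=> [|i]; first by rewrite Fgg; exact: cintegrableD.
    have -> : (fun z => F z * val z ^ i) =
        (fun z => g z * conjc (g z) * val z ^ i) \+ (fun z => - c%:C%C * val z ^ i).
      by apply/funext => z /=; rewrite Fgg mulrDl.
    rewrite cintegralD; [|exact: cintegrable_valX..].
    have [i0|i0] := eqVneq i 0.
      rewrite i0 [X in X + _](@eq_cintegral _ _ (fun z => g z * conjc (g z))); last first.
        by move=> z; rewrite expr0z mulr1.
      rewrite [X in _ + X](@eq_cintegral _ _ (fun=> - c%:C%C)); last first.
        by move=> z; rewrite expr0z mulr1.
      rewrite [X in X + _]dot_sqnorm.
      apply: complex_ext => /=; rewrite Rintegral_cst//
        [X in fine X](@probability_setT _ _ _ m) mulr1 ?subrr// oppr0 addr0//.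
    rewrite cintegralZ ?integral_valX// ?mulr0 ?addr0; last first.
      by apply: (@cintegrable_bdd _ _ 1) => [|z]; [exact: cmeasurable_valX|rewrite nsq_valX].
    case: i i0 => [[//|j] _|j _]; last by rewrite NegzE ggn.
    rewrite -[RHS]conjc0 -(ggn j) -cintegralJ; last exact: cintegrable_valX.
    apply: eq_cintegral => z; rewrite !rmorphM /= conjcK conjc_exprz ?nsq_val//.
    by rewrite opprK [conjc _ * _]mulrC.
  apply: filterS => z /(congr1 (@complex.Re R)); rewrite /F !reim /=.
  by move/eqP; rewrite subr_eq0 => /eqP.
pose s := (Num.sqrt c)^-1.
have s0 : s != 0 by rewrite invr_eq0 gt_eqF// sqrtr_gt0.
exists (fun z => s%:C%C * g z).
  by apply: L2_closureZ => //; apply: contra s0 => /eqP[->].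
apply: filterS gE => z gz; rewrite nsqM nsqR gz /s exprVn sqr_sqrtr ?ltW//.
by rewrite mulVf// gt_eqF.
Qed.

End Hardy.

(** * Dual truncated Toeplitz operators and extremal vectors *)

Section inner_functions.
Variable R : realType.
Local Notation m := (arc_length R).
Local Notation C := R[i].
Local Notation L2 := (cLp 2%:E).
Implicit Types (f g h u w phi : circle R -> C) (V : set (circle R -> C)).

Lemma cLnormy_le1 f : (cLnorm +oo f <= 1)%E <-> \forall z \ae m, nsq (f z) <= 1.
Proof.
rewrite /cLnorm unlock.
have -> : (0 < m setT)%E by rewrite [X in (_ < X)%E](@probability_setT _ _ _ m) lte01.
have E z : ((abse \o (fun z => (normc (f z))%:E)) z <= 1)%E = (nsq (f z) <= 1).
  by rewrite /= lee_fin ger0_norm ?normc_le1// normc_nsq sqrtr_ge0.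
by split=> [/ess_supP|h]; [|apply/ess_supP; move: h];
  apply: filterS => z; rewrite E.
Qed.

Lemma inner_nsq u : inner_fun u -> \forall z \ae m, nsq (u z) = 1.
Proof. by case=> _; apply: filterS => z /normc_eq1. Qed.

Lemma inner_nsq_le u : inner_fun u -> \forall z \ae m, nsq (u z) <= 1.
Proof. by move/inner_nsq; apply: filterS => z ->. Qed.

Lemma inner_H2 u : inner_fun u -> H2 u. Proof. by case=> [[]]. Qed.

Lemma inner_funP f : H2 f -> (\forall z \ae m, nsq (f z) = 1) -> inner_fun f.
Proof.
move=> Hf f1; split; last by apply: filterS f1 => z /normc_eq1.
split=> //; split; first exact/L2_meas/H2_L2.
apply: le_lt_trans (ltry 1); apply/cLnormy_le1.
by apply: filterS f1 => z ->.
Qed.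

Lemma unimodular_not_ae0 f : cmeasurable f -> (\forall z \ae m, nsq (f z) = 1) ->
  ~ (\forall z \ae m, f z = 0).
Proof.
move=> mf f1 f0.
have E : sqnorm (fun=> 1 : C) = sqnorm (fun=> 0 : C) :> R.
  apply: sqnorm_ae; [exact: cmeasurable_cst..|].
  apply: filterS2 f1 f0 => z + fz; rewrite fz nsq0 => /esym/eqP.
  by rewrite oner_eq0.
have one : sqnorm (fun=> 1 : C) = 1 :> R.
  by rewrite -[RHS](sqnorm_valX R 0); apply: eq_Rintegral => z _; rewrite expr0z.
have zero : sqnorm (fun=> 0 : C) = 0 :> R.
  rewrite /sqnorm; under eq_Rintegral do rewrite nsq0.
  by rewrite Rintegral_cst// mul0r.
by move/eqP: E; rewrite one zero oner_eq0.
Qed.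

(** Every element of the closed cyclic subspace of [h] vanishes where [h] does,
    and one of them is unimodular. *)
Lemma H2_neq0_ae h psi : L2 h -> L2_closure (polyspan h) psi ->
  (\forall z \ae m, nsq (psi z) = 1) -> \forall z \ae m, h z != 0.
Proof.
move=> Lh psic psi1; pose Z := [set z | nsq (h z) = 0].
have mZ : measurable Z.
  have := measurable_nsq (L2_meas Lh) measurableT (measurable_set1 0).
  by rewrite setTI.
pose w z : C := (\1_Z z)%:C%C.
have mw : cmeasurable w by exact: cmeasurable_indic.
have w1 : \forall z \ae m, nsq (w z) <= 1.
  apply: nearW => z; rewrite nsqR indicE; case: (_ \in _).
    by rewrite expr1n.
  by rewrite expr0n.
(* the zero function, written as a scalar multiple *)
have wh : w \* h = (fun=> 0 * 0).
  apply/funext => z; rewrite /= /w indicE mulr0; case: (boolP (z \in Z)) => zZ.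
    by move: zZ; rewrite inE => /nsq_eq0 ->; rewrite mulr0.
  by rewrite mul0r.
have Lpsi : L2 psi by case: psic.
have : \forall z \ae m, (w \* psi) z = 0.
  apply: fourier_eq0_ae => [|n]; first exact: L2_bmul w1 Lpsi.
  apply: (fourier_closure mw w1 Lh psic (N := n + 1)); last by rewrite ltrDl.
  by move=> i _; rewrite wh fourierZ ?mul0r//; exact: L2_cst.
apply: filterS2 psi1 => z psi1; rewrite /= /w => wpsi; apply/eqP => hz.
move: wpsi => /(congr1 (@nsq R)); rewrite nsqM psi1 nsq0 mulr1 nsqR indicE.
rewrite mem_set; last by rewrite /Z /= hz nsq0.
by move/eqP; rewrite expr1n oner_eq0.
Qed.

(** In the second case subtracting [oproj V f] leaves [f] unchanged, so that both
    cases lead to the same norm estimates. *)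
Lemma oprojP V f : (V (oproj V f) /\
  forall h, V h -> dotL2 (f \- oproj V f) h = 0) \/ oproj V f = cst 0.
Proof.
have [ex|nex] := pselect (exists g, V g /\ forall h, V h -> dotL2 (f \- g) h = 0).
  by left; exact: (xgetPex (cst 0) ex).
by right; apply: xgetPN => g h; apply: nex; exists g.
Qed.

Lemma model_space_L2 u g : model_space u g -> L2 g.
Proof. by case=> /H2_L2. Qed.

Lemma dual_toeplitz_L2 u phi f : L2 (phi \* f) -> L2 (dual_toeplitz u phi f).
Proof.
rewrite /dual_toeplitz => LF.
have [[/model_space_L2 LP _]|->] := oprojP (model_space u) (phi \* f).
  exact: L2B.
by apply: L2B => //; exact: L2_cst.
Qed.

Lemma sqnormB0 f : sqnorm (f \- cst 0) = sqnorm f.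
Proof. by apply: eq_Rintegral => z _ /=; rewrite subr0. Qed.

(** Pythagoras. *)
Lemma dual_toeplitz_le u phi f : L2 (phi \* f) ->
  sqnorm (dual_toeplitz u phi f) <= sqnorm (phi \* f).
Proof.
rewrite /dual_toeplitz => LF; set F := phi \* f in LF *.
have [[KP FP]|->] := oprojP (model_space u) F; last by rewrite sqnormB0.
set P := oproj _ _ in KP FP *; have LP := model_space_L2 KP.
have LFP : L2 (F \- P) by exact: L2B.
have -> : sqnorm F = sqnorm (F \- P) + sqnorm P; last by rewrite lerDl sqnorm_ge0.
apply: (@complexI R); rewrite rmorphD /= -!dot_sqnorm.
have := FP P KP; rewrite dotBl// => /eqP; rewrite subr_eq0 => /eqP FPP.
rewrite dotBl// !dotBr// FPP (dotC LP LF) FPP -(dotC LP LP).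
by rewrite subrr subr0 subrK.
Qed.

(** The projection of [phi \* f] is orthogonal to itself, hence null. *)
Lemma dual_toeplitz_orth u phi f : L2 (phi \* f) ->
  (forall g, model_space u g -> dotL2 (phi \* f) g = 0) ->
  sqnorm (dual_toeplitz u phi f) = sqnorm (phi \* f).
Proof.
rewrite /dual_toeplitz => LF FK; set F := phi \* f in LF FK *.
have [[KP FP]|->] := oprojP (model_space u) F; last by rewrite sqnormB0.
set P := oproj _ _ in KP FP *; have LP := model_space_L2 KP.
have := FP P KP; rewrite dotBl// FK// sub0r => /eqP.
rewrite oppr_eq0 dot_sqnorm => /eqP/(congr1 (@complex.Re R)) /= P0.
apply: sqnorm_ae; [exact/L2_meas/L2B|exact: L2_meas|].
by apply: filterS (sqnorm0_ae LP P0) => z /= ->; rewrite subr0.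
Qed.

Lemma dot_model_space u h g : inner_fun u -> H2 h -> model_space u g ->
  dotL2 (u \* h) g = 0.
Proof.
move=> iu Hh [Hg gu]; have Luh := H2_L2 (H2M (inner_H2 iu) (inner_nsq_le iu) Hh).
by rewrite (dotC Luh (H2_L2 Hg)) gu ?conjc0//; exists h.
Qed.

(** With h0 = psi u, both u h0 and phi u h0 = u chi are unimodular, and the
    latter lies in u H^2. The factor u in h0 is what makes phi u h0 orthogonal
    to the model space: h0 = psi would only give chi. *)
Lemma extremal_of_inner u psi chi phi : inner_fun u -> inner_fun psi ->
  inner_fun chi -> cmeasurable phi ->
  (\forall z \ae m, phi z = conjc (u z) * conjc (psi z) * chi z) ->
  exists h0, [/\ H2 h0, ~ (\forall z \ae m, h0 z = 0),
    extremal u phi (u \* h0) & H2 (phi \* (u \* h0))].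
Proof.
move=> iu ipsi ichi mphi phiE.
have u1 := inner_nsq iu; have psi1 := inner_nsq ipsi; have chi1 := inner_nsq ichi.
have H2prod w g : inner_fun w -> inner_fun g -> H2 (w \* g).
  by move=> iw ig; apply: H2M (inner_nsq_le iw) _; exact: inner_H2.
have Hh : H2 (psi \* u) by exact: H2prod.
have Hf : H2 (u \* (psi \* u)) by apply: H2M (inner_nsq_le iu) _ => //; exact: inner_H2.
have Huc : H2 (u \* chi) by exact: H2prod.
have mf := L2_meas (H2_L2 Hf).
have FE : \forall z \ae m, (u \* chi) z = (phi \* (u \* (psi \* u))) z.
  apply: filterS3 u1 psi1 phiE => z u1 psi1 /= ->.
  transitivity (u z * conjc (u z) * (psi z * conjc (psi z)) * (u z * chi z)).
    by rewrite !mulJ_nsq u1 psi1 !mul1r.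
  by ring.
have mF : cmeasurable (phi \* (u \* (psi \* u))) by exact: cmeasurableM.
have HF := H2_ae Huc mF FE.
have f1 : \forall z \ae m, nsq ((u \* (psi \* u)) z) = 1.
  by apply: filterS2 u1 psi1 => z u1 psi1; rewrite !nsqM u1 psi1 !mulr1.
exists (psi \* u); split => //.
  apply: unimodular_not_ae0; first exact/L2_meas/H2_L2.
  by apply: filterS2 u1 psi1 => z u1 psi1; rewrite nsqM u1 psi1 mulr1.
have LF := H2_L2 HF; split.
  by split; [exact: H2_L2|move=> g; exact: dot_model_space].
apply/cLnorm2_eq; [exact: dual_toeplitz_L2|exact: H2_L2|].
rewrite dual_toeplitz_orth//.
  apply: sqnorm_ae => //; apply: filterS3 f1 FE (inner_nsq (inner_funP Huc _)).
    by move=> z -> <- ->.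
  by apply: filterS2 u1 chi1 => z u1 chi1; rewrite nsqM u1 chi1 mulr1.
move=> g Kg; rewrite -(dot_model_space iu (inner_H2 ichi) Kg).
have mg := L2_meas (model_space_L2 Kg).
apply: ae_eq_dot => //; [exact/L2_meas/H2_L2| |exact: nearW].
by apply: filterS FE => z ->.
Qed.

(** Extremality forces |phi| = 1 where h0 does not vanish, that is, almost
    everywhere. Multiplication by phi u is then isometric and sends h0 into H^2,
    hence also the inner function psi that generates the cyclic subspace of
    h0. *)
Lemma inner_of_extremal u phi h0 : inner_fun u -> cmeasurable phi ->
  (\forall z \ae m, nsq (phi z) <= 1) -> H2 h0 ->
  ~ (\forall z \ae m, h0 z = 0) -> extremal u phi (u \* h0) ->
  H2 (phi \* (u \* h0)) ->
  exists psi chi, [/\ inner_fun psi, inner_fun chi &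
    \forall z \ae m, phi z = conjc (u z) * conjc (psi z) * chi z].
Proof.
move=> iu mphi phi1 Hh h0n0 [[Lf _] ext] HF.
have Lh := H2_L2 Hh; have LF := H2_L2 HF; have u1 := inner_nsq iu.
have mu := L2_meas (H2_L2 (inner_H2 iu)).
have [psi psic psi1] := inner_in_closure Hh h0n0.
have h0neq := H2_neq0_ae Lh psic psi1.
have phi_unimodular : \forall z \ae m, nsq (phi z) = 1.
  have sqF : sqnorm (phi \* (u \* h0)) = sqnorm (u \* h0).
    apply/eqP; rewrite eq_le sqnorm_bmul_le//=.
    rewrite -(proj1 (cLnorm2_eq (dual_toeplitz_L2 u LF) Lf) ext).
    exact: dual_toeplitz_le.
  have : \forall z \ae m, nsq ((u \* h0) z) - nsq ((phi \* (u \* h0)) z) = 0.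
    apply: Rintegral_eq0_ae.
    - by apply: filterS phi1 => z phi1; rewrite subr_ge0 nsqM ler_piMl// nsq_ge0.
    - rewrite /comp; under eq_fun do rewrite -mulN1r.
      exact: integrableRD (L2_int Lf) (integrableRZ _ (L2_int LF)).
    - rewrite RintegralB//; [|exact: L2_int..].
      by apply/eqP; rewrite subr_eq0; apply/eqP; exact: esym sqF.
  apply: filterS3 u1 h0neq => z u1 hz /eqP; rewrite subr_eq0 !nsqM u1 mul1r.
  move=> /eqP E; have hz0 : nsq (h0 z) != 0.
    by apply: contra hz => /eqP/nsq_eq0 ->.
  by apply: (mulIf hz0); rewrite mul1r.
pose w := phi \* u.
have mw : cmeasurable w by exact: cmeasurableM.
have w1 : \forall z \ae m, nsq (w z) = 1.
  by apply: filterS2 u1 phi_unimodular => z u1 p1; rewrite nsqM u1 p1 mulr1.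
have w1le : \forall z \ae m, nsq (w z) <= 1 by apply: filterS w1 => z ->.
have wh : w \* h0 = phi \* (u \* h0) by apply/funext => z /=; rewrite mulrA.
exists psi, (w \* psi); split.
- exact: inner_funP (H2_closure Hh psic) psi1.
- apply: inner_funP.
    split; first by apply: (L2_bmul mw w1le); case: psic.
    by apply: (fourier_closure mw w1le Lh psic); rewrite wh; case: HF.
  by apply: filterS2 w1 psi1 => z w1 p1; rewrite nsqM w1 p1 mulr1.
- apply: filterS2 u1 psi1 => z u1 p1 /=.
  transitivity (u z * conjc (u z) * (psi z * conjc (psi z)) * phi z).
    by rewrite !mulJ_nsq u1 p1 !mul1r.
  by rewrite /w /=; ring.
Qed.

End inner_functions.

Theorem theorem3p19 (R : realType) (u phi : circle R -> R[i])
    (u_inner : inner_fun u) (u_nonconstant : ~ ae_constant u)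
    (phi_Loo : cLp +oo%E phi) (phi_norm1 : cLnorm +oo%E phi = 1%E) :
  (exists psi chi : circle R -> R[i],
     [/\ inner_fun psi, inner_fun chi &
         \forall z \ae arc_length R,
           phi z = conjc (u z) * conjc (psi z) * chi z])
  <->
  (exists h0 : circle R -> R[i],
     [/\ H2 h0, ~ (\forall z \ae arc_length R, h0 z = 0),
         extremal u phi (u \* h0) & H2 (phi \* (u \* h0))]).
Proof.
have [mphi _] := phi_Loo.
have phi1 : \forall z \ae arc_length R, nsq (phi z) <= 1.
  by apply/cLnormy_le1; rewrite phi_norm1.
split=> [[psi [chi [ipsi ichi phiE]]]|[h0 [Hh h0n0 ext HF]]].
  exact: (extremal_of_inner u_inner ipsi ichi mphi phiE).
exact: (inner_of_extremal u_inner mphi phi1 Hh h0n0 ext HF).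
Qed.
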